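(* Let $\lambda$ be a nonempty partition with at most $n$ parts. Then $$\mathfrak{K}^{(\beta)}_\lambda(x_1,\dots,x_n)=\sum_{T\in\mathrm{QSV}_n(\lambda)}\beta^{|T|-|\lambda|}\,\mathcal{G}^{(\beta)}_{\mathrm{rev}(\mathrm{wt}(T))}(x_1,\dots,x_n).$$
   Context: Lehmer code: for a permutation $w$, $L(w)_i=\#\{j>i: w(i)>w(j)\}$. For a partition $\lambda=(\lambda_1\ge\lambda_2\ge\dots)$ with at most $n$ parts (padded by zeros), let $w$ be the unique (Grassmannian) permutation with $L(w)=(\lambda_n,\lambda_{n-1},\dots,\lambda_1,0,0,\dots)$, and set $\mathfrak{K}^{(\beta)}_\lambda(x_1,\dots,x_n):=\mathfrak{K}^{(\beta)}_w$, where $\mathfrak{K}^{(\beta)}_w=\sum_{P\in\mathrm{PD}(w)}\beta^{\mathrm{ex}(P)}x^{\mathrm{wt}(P)}$ is the $\beta$-Grothendieck polynomial (pipe dreams $P$: fillings of cells $(i,j)$ by crosses/elbows with finitely many crosses; reduction keeps only the southwestmost cross between each pair of pipes; permutation of $P$ is that of its reduction, i.e. Demazure product convention; $\mathrm{ex}(P)$ = number of crosses of $P$ minus those of its reduction; $\mathrm{wt}(P)_i$ = number of crosses in row $i$; equivalently this is the Fomin–Kirillov $\beta$-Grothendieck polynomial, equal to Lascoux–Schützenberger's at $\beta=-1$). A set-valued tableau of shape $\lambda$ fills each box of the English Young diagram of $\lambda$ with a nonempty finite set of positive integers so that the minimum of the box immediately right of a box with set $A$ is $\ge\max A$, and the minimum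 of the box immediately below is $>\max A$. $\mathrm{wt}(T)$ is the weak composition of length $n$ whose $i$th entry is the number of boxes containing $i$; $|T|$ is the total number of entries; $|\lambda|$ the number of boxes. $T$ is quasi-Yamanouchi if for every $i>1$ occurring in $T$ there is a box containing $i$ lying in a column weakly left of a different box containing $i-1$. $\mathrm{QSV}_n(\lambda)$ is the set of quasi-Yamanouchi set-valued tableaux of shape $\lambda$ with entries in $\{1,\dots,n\}$. $\mathrm{rev}(c)$ reverses a length-$n$ weak composition. Glide polynomials: a weak komposition is a weak composition whose positive entries are colored black or red, $\mathrm{ex}(b)$ = number of red entries, $\mathtt{flat}(a)$ = nonzero entries of $a$. For $a$ of length $n$ with nonzero entries exactly at positions $n_1<\dots<n_\ell$, $b$ is a glide of $a$ if there exist $0=i_0<\dots<i_\ell$ with $i_j\le n_j$, $b_k=0$ for $k>i_\ell$, and for each $j$: $b_{i_{j-1}+1}+\dots+b_{i_j}=\mathtt{flat}(a)_j+\#\{\text{red entries among } b_{i_{j-1}+1},\dots,b_{i_j}\}$ and the first nonzero entry among them is black. $\mathcal{G}^{(\beta)}_a=\sum_b\beta^{\mathrm{ex}(b)}x^b$ over glides $b$ of $a$. *)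

(* Defs.v *)
From HB Require Import structures.
From mathcomp Require Import all_boot all_order all_algebra.
Set Implicit Arguments. Unset Strict Implicit. Unset Printing Implicit Defensive.
Import Order.TTheory GRing.Theory Num.Theory.

(* A permutation of {1,2,...} is represented by a function nat -> nat
   (the value at 0 is irrelevant).  s_a (a >= 1) swaps a and a+1. *)
Definition swapn (a i : nat) : nat :=
  if i == a then a.+1 else if i == a.+1 then a else i.

(* Demazure product of a word a_1 ... a_m (letters >= 1), composing
   w := w \o s_a when this increases length (w(a) < w(a+1)), else w. *)
Definition demazure (word : seq nat) : nat -> nat :=
  foldl (fun w a => if w a < w a.+1 then (fun i => w (swapn a i)) else w)
        id word.

(* Lehmer code L(w)_i = #{ j > i : w(i) > w(j) }, computed for permutations
   of {1..N} (fixing every integer > N). *)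
Definition lehmer (N : nat) (w : nat -> nat) (i : nat) : nat :=
  count (fun j => w j < w i) (iota i.+1 (N - i)).

Definition invs (N : nat) (w : nat -> nat) : nat :=
  \sum_(1 <= i < N.+1) lehmer N w i.

Definition grass_code (n : nat) (lam : seq nat) (i : nat) : nat :=
  if (1 <= i <= n) then nth 0 lam (n - i) else 0.

(* A pipe dream with crosses in the N x N box; the pair (i,j) : 'I_N * 'I_N
   stands for the cell (i+1, j+1), whose cross corresponds to s_{i+j+1}.
   Reading word: rows top to bottom, each row right to left. *)
Definition reading_word (N : nat) (P : {set 'I_N * 'I_N}) : seq nat :=
  flatten [seq [seq (val i + val j).+1 | j <- rev (enum 'I_N) & (i, j) \in P]
          | i <- enum 'I_N].

(* P is a pipe dream (inside the staircase i+j <= N, 1-based) whose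
   Demazure permutation has Lehmer code c. *)
Definition is_pd (N : nat) (c : nat -> nat) (P : {set 'I_N * 'I_N}) : bool :=
  [forall p : 'I_N * 'I_N, (p \in P) ==> (val p.1 + val p.2 + 2 <= N)] &&
  [forall i : 'I_N, lehmer N (demazure (reading_word P)) i.+1 == c i.+1].

Definition groth_box (R : comPzRingType) (N : nat) (c : nat -> nat)
    (beta : R) (x : nat -> R) : R :=
  \sum_(P : {set 'I_N * 'I_N} | is_pd c P)
     beta ^+ (#|P| - invs N (demazure (reading_word P)))
     * \prod_(p in P) x (val p.1).+1.

Definition is_partition (lam : seq nat) : bool :=
  sorted geq lam && all (fun p => 0 < p) lam.

(* Tableaux of shape lam with entries in {1..n}: entry v : 'I_n stands for
   the integer v+1; box (r,c) : 'I_n * 'I_m is (row r+1, column c+1),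
   m = lam_1.  Boxes outside the shape carry the empty set. *)
Definition tabT (n : nat) (lam : seq nat) :=
  {ffun 'I_n * 'I_(head 0 lam) -> {set 'I_n}}.

Definition inshape (lam : seq nat) (r c : nat) : bool := c < nth 0 lam r.

Definition tget (n : nat) (lam : seq nat) (T : tabT n lam) (r c : nat)
    : {set 'I_n} :=
  match insub r, insub c with
  | Some r', Some c' => T (r', c')
  | _, _ => set0
  end.

Definition is_svt (n : nat) (lam : seq nat) (T : tabT n lam) : bool :=
  [forall b : 'I_n * 'I_(head 0 lam),
     inshape lam b.1 b.2 == (T b != set0)] &&
  [forall r : 'I_n, forall c : 'I_(head 0 lam),
     inshape lam r c.+1 ==>
     [forall a in tget T r c, forall b in tget T r c.+1, val a <= val b]] &&
  [forall r : 'I_n, forall c : 'I_(head 0 lam),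
     inshape lam r.+1 c ==>
     [forall a in tget T r c, forall b in tget T r.+1 c, val a < val b]].

Definition is_qy (n : nat) (lam : seq nat) (T : tabT n lam) : bool :=
  [forall v : 'I_n, ((0 < val v) && [exists b, v \in T b]) ==>
     [exists b1, exists b2, exists u : 'I_n,
        [&& (val u).+1 == val v, b1 != b2, v \in T b1, u \in T b2
          & val b1.2 <= val b2.2]]].

Definition QSV (n : nat) (lam : seq nat) (T : tabT n lam) : bool :=
  is_svt T && is_qy T.

Definition tab_wt (n : nat) (lam : seq nat) (T : tabT n lam) : seq nat :=
  [seq #|[set b | v \in T b]| | v <- enum 'I_n].

Definition tab_size (n : nat) (lam : seq nat) (T : tabT n lam) : nat :=
  \sum_b #|T b|.

(* A weak komposition of length n = size a is b : 'I_n -> nat * bool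
   (entry, red?); only positive entries may be red.  Entries of a glide are
   bounded by |a| + n, so the finite range 'I_(|a|+n+1) contains all glides. *)
Definition glide_bound (a : seq nat) := sumn a + size a + 1.

Definition kompT (a : seq nat) :=
  {ffun 'I_(size a) -> 'I_(glide_bound a) * bool}.

Definition is_glide (a : seq nat) (b : kompT a) : bool :=
  let n := size a in
  let pos := [seq k <- iota 0 n | nth 0 a k != 0] in
  let l := size pos in
  [forall k : 'I_n, (b k).2 ==> (0 < val (b k).1)] &&
  [exists s : l.-tuple 'I_n.+1,
     let ii j := nth 0 (0 :: map val s) j in
     [forall j : 'I_l,
        [&& ii j < ii j.+1,
            ii j.+1 <= (nth 0 pos j).+1,
            \sum_(k : 'I_n | ii j <= val k < ii j.+1) val (b k).1
              == nth 0 a (nth 0 pos j)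
                 + #|[set k : 'I_n | (ii j <= val k < ii j.+1) && (b k).2]|
          & [forall k : 'I_n,
               [&& ii j <= val k < ii j.+1, val (b k).1 != 0 &
                   [forall k' : 'I_n, (ii j <= val k' < val k) ==>
                                      (val (b k').1 == 0)]]
               ==> ~~ (b k).2]]] &&
     [forall k : 'I_n, (ii l <= val k) ==> (val (b k).1 == 0)]].

Definition glide_poly (R : comPzRingType) (a : seq nat) (beta : R)
    (x : nat -> R) : R :=
  \sum_(b : kompT a | is_glide b)
     beta ^+ #|[set k | (b k).2]| * \prod_(k < size a) x k.+1 ^+ val (b k).1.

(* Main.v *)
Require Import Defs.
From HB Require Import structures.
From mathcomp Require Import all_boot all_order all_algebra zify.
From Stdlib Require Import FunctionalExtensionality.
Set Implicit Arguments. Unset Strict Implicit. Unset Printing Implicit Defensive.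
Import GRing.Theory.

(** Pipe dreams and set-valued tableaux are both encoded by words.  A word is
  cut into [n] strictly increasing rows; row [v] of the word lists the letters
  [i + j] of the crosses [(i, j)] of row [i = n - 1 - v] of a pipe dream, or the
  contents [n - 1 - r + c] of the boxes [(r, c)] of a tableau that contain [v]
  (everything is counted from 0).

  Particles [0, ..., n - 1] start at their own index and the letter [a] moves a
  particle from [a] to [a + 1].  Left multiplication by [s_a] in the 0-Hecke
  monoid keeps a Grassmannian permutation Grassmannian exactly when one and only
  one of [a], [a + 1] is occupied, and the word is a word of the shape [lam] if
  this holds at every letter and the particles end at distances [lam] from their
  origins.  Reading the same motion as the growth of a Young diagram gives the
  bijections between pipe dreams, words and set-valued tableaux.

  Being a word of [lam] is insensitive to merging equal consecutive letters.
  The words with a given merged word [e] have as generating function the glide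
  polynomial of the reversed lengths of the increasing runs of [e], since both
  satisfy the same recursion on the number of variables; the quasi-Yamanouchi
  tableaux are those whose rows are exactly the increasing runs of their word. *)

(** * Merged words and increasing runs *)

(** The Demazure product is built by right multiplication, but the state to be followed is the set
    of values at the first [n] positions, on which left multiplication acts. The two multiplications
    commute, so the reading word may be read backwards, rows from bottom to top. A descent is never
    destroyed by left multiplication, so a word that has once produced a descent away from [n] is
    lost for good. The two recursions agree for this reason: a row of [b] letters uses up [b]
    letters of the merged word, or only [b - 1] if its last letter merges into the next row, and the
    second case costs one [beta]; a red entry [b] likewise adds only [b - 1] to its block. The
    bounds $i_j \le n_j$ on glides have no counterpart on words. They hold automatically: the empty
    rows of a quasi-Yamanouchi tableau come last, so the nonzero entries of the reversed weight fill
    its last places, and strictly increasing block ends that stay within [n] satisfy the bounds. *)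

Definition dedup_cons (x : nat) (t : seq nat) : seq nat :=
  if ohead t == Some x then t else x :: t.

Definition dedup (s : seq nat) : seq nat := foldr dedup_cons [::] s.

Definition nadj : pred (seq nat) := sorted (fun x y => x != y).

Lemma nadj_dedup_cons x t : nadj t -> nadj (dedup_cons x t).
Proof.
rewrite /dedup_cons; case: eqP => // h; case: t h => //= y t h ->.
by rewrite andbT; apply/eqP => e; apply: h; rewrite e.
Qed.

Lemma nadj_dedup s : nadj (dedup s).
Proof. by elim: s => //= x s; apply: nadj_dedup_cons. Qed.

Lemma size_dedup_cons x t : size t <= size (dedup_cons x t) <= (size t).+1.
Proof. by rewrite /dedup_cons; case: ifP => /=; lia. Qed.

Lemma size_dedup s : size (dedup s) <= size s.
Proof. by elim: s => //= x s IH; have := size_dedup_cons x (dedup s); lia. Qed.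

Lemma dedup_sub s : {subset dedup s <= s}.
Proof.
elim: s => //= x s IH y; rewrite /dedup_cons; case: ifP => _; rewrite !inE.
  by move/IH->; rewrite orbT.
by case/orP => [->//|/IH ->]; rewrite orbT.
Qed.

Lemma dedup_cat u w : dedup (u ++ w) = foldr dedup_cons (dedup w) u.
Proof. by rewrite /dedup foldr_cat. Qed.

(** Inside a strictly increasing row each letter is followed by a larger one, so only its last
    letter can merge with what comes next. *)
Lemma foldr_dedup_rcons u a t :
  sorted ltn (rcons u a) -> foldr dedup_cons t (rcons u a) = u ++ dedup_cons a t.
Proof.
elim: u => //= x u IH h.
have hs : sorted ltn (rcons u a) by move: h; case: (u) => //= y v /andP[].
rewrite IH // /dedup_cons; case: u h {IH hs} => [|y u] /=.
  rewrite andbT => xa; case: (ohead t =P Some a) => [->|_] /=.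
    by case: eqP => // -[]; lia.
  by case: eqP => // -[]; lia.
by case/andP => xy _; case: eqP => // -[]; lia.
Qed.

(** The merged tail starts either after the last letter of [A] or with that very letter, which it
    then absorbs. The second alternative becomes the red entry of a glide. *)
Lemma dedup_cat_eq A w e : sorted ltn A -> nadj e ->
  (dedup (A ++ w) == e) =
  (A == take (size A) e) &&
  ((dedup w == drop (size A) e) || (0 < size A) && (dedup w == drop (size A).-1 e)).
Proof.
case/lastP: A => [|A a] sA ne; first by rewrite /= take0 drop0 eqxx orbF.
rewrite dedup_cat foldr_dedup_rcons // size_rcons /=.
apply/eqP/andP => [<-|[/eqP hA]].
  rewrite /dedup_cons; case: (ohead (dedup w) =P Some a) => h.
    case: (dedup w) h => //= y t [->].
    have -> : A ++ a :: t = rcons A a ++ t by rewrite cat_rcons.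
    rewrite take_size_cat ?size_rcons // eqxx; split=> //.
    by apply/orP; right; rewrite cat_rcons drop_size_cat.
  rewrite -cat_rcons take_size_cat ?size_rcons // eqxx; split=> //.
  by rewrite drop_size_cat ?size_rcons ?eqxx.
have ee : rcons A a ++ drop (size A).+1 e = e by rewrite {1}hA cat_take_drop.
case/orP => /eqP ->.
  rewrite /dedup_cons; case: eqP => [h|_]; last by rewrite -cat_rcons.
  move: ne; rewrite -ee; case: (drop _ e) h => //= y t [->].
  by rewrite /nadj cat_rcons sorted_cat_cons /= eqxx andbF.
have -> : drop (size A) e = a :: drop (size A).+1 e.
  rewrite -{1}ee cat_rcons drop_size_cat //.
by rewrite /dedup_cons /= eqxx -cat_rcons.
Qed.

(** * Increasing runs and their lengths *)

Fixpoint run_lengths (s : seq nat) : seq nat :=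
  if s is x :: s' then
    if s' is y :: _ then
      if x < y then (head 0 (run_lengths s')).+1 :: behead (run_lengths s') else 1 :: run_lengths s'
    else [:: 1]
  else [::].

Arguments run_lengths : simpl never.

Lemma run_lengths2 x y s : run_lengths [:: x, y & s] =
  if x < y then (head 0 (run_lengths (y :: s))).+1 :: behead (run_lengths (y :: s))
  else 1 :: run_lengths (y :: s).
Proof. by []. Qed.

(** A run that is used up, or a block that is filled, has to disappear, so that the lists of lengths
    keep only positive parts. *)
Definition cons_pos (y : nat) (c : seq nat) := if y == 0 then c else y :: c.

Lemma run_lengths_gt0 s : all (fun y => 0 < y) (run_lengths s).
Proof.
elim: s => // x [|y s] //; rewrite run_lengths2; case: ifP => _ /=; last by move->.
by case: (run_lengths _) => //= z t /andP[].
Qed.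

Lemma run_lengths_nil s : (run_lengths s == [::]) = (s == [::]).
Proof. by case: s => // x [|y s] //; rewrite run_lengths2; case: ifP. Qed.

Lemma run_lengths_cons x s : run_lengths (x :: s) != [::].
Proof. by rewrite run_lengths_nil. Qed.

Lemma cons_pos_run_lengths s : cons_pos (head 0 (run_lengths s)) (behead (run_lengths s)) = run_lengths s.
Proof.
by have := run_lengths_gt0 s; case: (run_lengths s) => //= x t /andP[h _]; rewrite /cons_pos; case: eqP h => // ->.
Qed.

Lemma run_lengths_behead x s : run_lengths s = cons_pos (head 0 (run_lengths (x :: s))).-1 (behead (run_lengths (x :: s))).
Proof.
case: s => [|y s] //; rewrite run_lengths2; case: ifP => _ //.
by rewrite [_.-1]/= cons_pos_run_lengths.
Qed.

Lemma head_run_lengths_cons x s : 0 < head 0 (run_lengths (x :: s)).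
Proof. by have := run_lengths_gt0 (x :: s); have := run_lengths_cons x s; case: (run_lengths _) => //= a t _ /andP[]. Qed.

Lemma run_lengths_drop b s : b <= head 0 (run_lengths s) ->
  run_lengths (drop b s) = cons_pos (head 0 (run_lengths s) - b) (behead (run_lengths s)).
Proof.
elim: b s => [|b IH] s; first by rewrite drop0 subn0 cons_pos_run_lengths.
case: s => [|x s] // h; rewrite [drop _ _]/=.
have e := run_lengths_behead x s; have h0 := head_run_lengths_cons x s.
move: h h0 e; case: (run_lengths (x :: s)) => //= c1 c' hb h0 e.
case: (posnP b) => [->|b0].
  by rewrite drop0 e subn1.
have hc : c1.-1 != 0 by lia.
rewrite IH e /cons_pos (negbTE hc) /=; last by lia.
by have -> : c1.-1 - b = c1 - b.+1 by lia.
Qed.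

(** This is why the length of the first row is its only freedom: an increasing prefix is one that
    stays inside the first run. *)
Lemma sorted_take_run_lengths b s :
  (b <= size s) && sorted ltn (take b s) = (b <= head 0 (run_lengths s)).
Proof.
elim: b s => [|b IH] [|x s] //; rewrite [size _]/= ltnS [take _ _]/=.
case: s IH => [|y s] IH; first by case: b {IH}.
have := IH (y :: s); have h0 := head_run_lengths_cons y s.
rewrite run_lengths2; case: b IH => [|b] IH.
  by move=> _; case: ifP.
rewrite [take _ (y :: s)]/= [sorted _ (x :: _)]/= => IH'.
case: ifP => xy; rewrite ?xy /= ltnS; last by rewrite andbF.
exact: IH'.
Qed.

Lemma head_run_lengths_size s : head 0 (run_lengths s) <= size s.
Proof. by have := sorted_take_run_lengths (head 0 (run_lengths s)) s; rewrite leqnn => /andP[]. Qed.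

Fixpoint runs (s : seq nat) : seq (seq nat) :=
  if s is x :: s' then
    if s' is y :: _ then
      if x < y then (x :: head [::] (runs s')) :: behead (runs s')
      else [:: x] :: runs s'
    else [:: [:: x]]
  else [::].

Arguments runs : simpl never.

Lemma runs2 x y s : runs [:: x, y & s] =
  if x < y then (x :: head [::] (runs (y :: s))) :: behead (runs (y :: s))
  else [:: x] :: runs (y :: s).
Proof. by []. Qed.

Lemma shape_runs s : [seq size q | q <- runs s] = run_lengths s.
Proof.
elim: s => // x [|y s] // IH; rewrite run_lengths2 runs2 -IH; case: ifP => _ //=.
by case: (runs _).
Qed.

Lemma flatten_runs s : flatten (runs s) = s.
Proof.
elim: s => // x [|y s] // IH; rewrite runs2.
case: ifP => _ /=; last by rewrite IH.
by rewrite -[in RHS]IH; case: (runs (y :: s)).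
Qed.

(** Strictness rules out two things between consecutive rows: equal letters, which would merge, and
    a larger next letter, which would continue the run. The implication also forbids a nonempty row
    after an empty one. *)
Fixpoint qy_rows (qs : seq (seq nat)) : bool :=
  if qs is q :: qs' then
    (if qs' is q' :: _ then
       (q' != [::]) ==> ((q != [::]) && (head 0 q' < last 0 q))
     else true) && qy_rows qs'
  else true.

Lemma qy_rows_nil qs : qy_rows ([::] :: qs) -> qs = nseq (size qs) [::].
Proof.
elim: qs => // q qs IH /= /andP[]; rewrite implybF negbK => /eqP -> h.
by rewrite {1}IH.
Qed.

Lemma runs_cat q s : sorted ltn q -> q != [::] ->
  (s != [::] -> head 0 s < last 0 q) -> runs (q ++ s) = q :: runs s.
Proof.
elim: q => // x q IH; case: q IH => [|y q] IH h _ hs.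
  by case: s hs {IH} => //= y s /(_ isT) yx; rewrite runs2 ltnNge (ltnW yx).
move: h => /= /andP[xy h].
rewrite [LHS](_ : _ = (x :: head [::] (runs ((y :: q) ++ s))) :: behead (runs ((y :: q) ++ s))).
  by rewrite IH.
by rewrite [_ ++ _]/= runs2 xy.
Qed.

(** No row continues into its successor, so the nonempty rows are the maximal runs and the empty
    ones are padding at the end. Hence the word and the number of rows determine the filling. *)
Lemma qy_rows_runs qs : all (sorted ltn) qs -> qy_rows qs ->
  qs = runs (flatten qs) ++ nseq (size qs - size (runs (flatten qs))) [::].
Proof.
elim: qs => // q qs IH; rewrite [all _ _]/= => /andP[sq sqs] hq.
have hq' : qy_rows qs by case/andP: hq.
case: (eqVneq q [::]) => [q0|q0].
  move: hq; rewrite q0 => /qy_rows_nil ->; rewrite /= size_nseq.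
  suff -> : flatten (nseq (size qs) [::]) = [::] :> seq nat by [].
  by elim: (size qs).
rewrite [flatten _]/= runs_cat // => [|h]; first by rewrite /= subSS {1}IH.
case: qs hq hq' h {IH sqs} => // q' qs /= /andP[h1 h2] h3.
case: (eqVneq q' [::]) h1 => [q'0|/= h]; last by case: q' h {h2 h3} => //= a q' _ /andP[].
move=> _; move: h2; rewrite q'0 => /qy_rows_nil ->.
by elim: (size qs) => //=.
Qed.

Lemma head_runs x s : exists q qs, runs (x :: s) = (x :: q) :: qs.
Proof.
case: s => [|y s]; first by exists [::], [::].
rewrite runs2; case: ifP => _; first by eexists _, _.
by exists [::], (runs (y :: s)).
Qed.

Lemma runs_sorted s : all (sorted ltn) (runs s).
Proof.
elim: s => // x [|y s] // IH; rewrite runs2.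
have [q [qs e]] := head_runs y s; move: IH; rewrite e /= => /andP[h1 h2].
by case: ifP => xy /=; rewrite ?xy h1 h2.
Qed.

Lemma runs_qy_rows s : nadj s -> qy_rows (runs s).
Proof.
elim: s => // x [|y s] // IH; rewrite runs2 [nadj _]/= => /andP[nxy h].
have [q [qs e]] := head_runs y s; move: (IH h); rewrite e /=.
case/andP => h1 h2; case: ifP => xy /=; first by rewrite h1.
by rewrite h1 h2 !andbT; lia.
Qed.

Lemma qy_rows_cat_nil qs k : qy_rows qs -> qy_rows (qs ++ nseq k [::]).
Proof.
elim: qs => [_|q qs IH] /=.
  by elim: k => //= k ->; case: k.
case/andP => h1 h2; rewrite IH // andbT; case: qs h1 {IH h2} => //=.
by case: k.
Qed.

Lemma size_run_lengths_cat A t : sorted ltn A -> size (run_lengths (A ++ t)) <= (size (run_lengths t)).+1.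
Proof.
elim: A => [|x A IH] // h.
have {}IH := IH (path_sorted h); case: A h IH => [|y A] h IH.
  case: t {IH} => // y t; rewrite run_lengths2; case: ifP => // _.
  by case: (run_lengths (y :: t)) => //=; lia.
move: h IH; rewrite /= run_lengths2 => /andP[-> _] /= IH; rewrite size_behead.
by move: IH; case: (size _).
Qed.

Lemma size_run_lengths_dedup A w : sorted ltn A ->
  size (run_lengths (dedup (A ++ w))) <= (size (run_lengths (dedup w))).+1.
Proof.
case/lastP: A => [|A a] // h; rewrite dedup_cat foldr_dedup_rcons //.
have hA : sorted ltn A by apply: (subseq_sorted ltn_trans (subseq_rcons A a)).
by rewrite /dedup_cons; case: ifP => _; rewrite -?cat_rcons; apply: size_run_lengths_cat.
Qed.

(** A row creates at most one new run. The runs of a merged word therefore fit into the rows at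
    hand. *)
Lemma size_run_lengths_flatten ds : all (sorted ltn) ds ->
  size (run_lengths (dedup (flatten ds))) <= size ds.
Proof.
elim: ds => //= A ds IH /andP[h /IH{}IH].
exact: leq_trans (size_run_lengths_dedup _ h) _.
Qed.

(** * Particles *)

Definition hop (a x : nat) : nat := if x == a then a.+1 else x.

Definition run (p : nat -> nat) (u : seq nat) : nat -> nat :=
  foldl (fun p a i => hop a (p i)) p u.

Definition occ (n : nat) (p : nat -> nat) (a : nat) : bool :=
  has (fun i => p i == a) (iota 0 n).

Fixpoint valid (n : nat) (p : nat -> nat) (u : seq nat) : bool :=
  if u is a :: u' then
    (occ n p a != occ n p a.+1) && valid n (fun i => hop a (p i)) u'
  else true.

(* Particle [i] carries the part [nth 0 lam (n - i.+1)]: the last particle moves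
   by the largest part. *)
Definition word_of (n : nat) (lam u : seq nat) : bool :=
  valid n id u &&
  all (fun i => run id u i == nth 0 lam (n - i.+1) + i) (iota 0 n).

Lemma occP n p a : reflect (exists2 i, i < n & p i = a) (occ n p a).
Proof.
apply: (iffP hasP) => [[i]|[i h e]].
  by rewrite mem_iota => /andP[_ h] /eqP e; exists i.
by exists i; [rewrite mem_iota | apply/eqP].
Qed.

Lemma run_cat p u v : run p (u ++ v) = run (run p u) v.
Proof. by rewrite /run foldl_cat. Qed.

Lemma valid_cat n p u v : valid n p (u ++ v) = valid n p u && valid n (run p u) v.
Proof. by elim: u p => //= a u IH p; rewrite IH andbA. Qed.

Lemma run_ext p q u : p =1 q -> run p u =1 run q u.
Proof.
elim: u p q => //= a u IH p q e; apply: IH => i; by rewrite e.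
Qed.

Lemma occ_ext n p q a : p =1 q -> occ n p a = occ n q a.
Proof. by move=> e; apply: eq_has => i; rewrite e. Qed.

Lemma valid_ext n p q u : p =1 q -> valid n p u = valid n q u.
Proof.
elim: u p q => //= a u IH p q e; rewrite !(occ_ext _ _ e); congr (_ && _).
by apply: IH => i; rewrite e.
Qed.

Lemma hop_idem a x : hop a (hop a x) = hop a x.
Proof. by rewrite /hop; case: (x =P a) => [_|/eqP/negbTE ->//]; case: ifP => //; lia. Qed.

(** Whether a particle moves or already stands at [a.+1], the letter leaves [a] empty and [a.+1]
    occupied. A repetition of the letter is thus allowed and moves nothing, which is why merging is
    harmless. *)
Lemma occ_hop n p a : occ n p a != occ n p a.+1 ->
  ~~ occ n (fun i => hop a (p i)) a && occ n (fun i => hop a (p i)) a.+1.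
Proof.
move=> h; apply/andP; split.
  by apply/occP => -[i _]; rewrite /hop; case: eqP => //; lia.
have: exists2 i, i < n & p i = a \/ p i = a.+1.
  move: h; case: (occP n p a) => [[i ? ?] _|_]; first by exists i; [|left].
  by case: (occP n p a.+1) => [[i ? ?] _|//]; exists i; [|right].
case=> i hi e; apply/occP; exists i => //; rewrite /hop.
by case: eqP => //; case: e.
Qed.

Lemma valid_dedup_cons n p x t : valid n p (dedup_cons x t) = valid n p (x :: t).
Proof.
rewrite /dedup_cons; case: eqP => //; case: t => // y t [->] /=.
rewrite (@valid_ext n (fun i => hop x (hop x (p i))) (fun i => hop x (p i))); last first.
  by move=> i; rewrite hop_idem.
case: (boolP (_ != _)) => //= h.
by have /andP[/negbTE -> ->] := occ_hop h.
Qed.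

Lemma run_dedup_cons p x t : run p (dedup_cons x t) =1 run p (x :: t).
Proof.
rewrite /dedup_cons; case: eqP => //; case: t => // y t [->] i /=.
by apply: run_ext => j; rewrite hop_idem.
Qed.

Lemma valid_dedup n p u : valid n p (dedup u) = valid n p u.
Proof. by elim: u p => //= x u IH p; rewrite valid_dedup_cons /= IH. Qed.

Lemma run_dedup p u : run p (dedup u) =1 run p u.
Proof. by elim: u p => //= x u IH p i; rewrite run_dedup_cons /= IH. Qed.

Lemma word_of_dedup n lam u : word_of n lam (dedup u) = word_of n lam u.
Proof.
by rewrite /word_of valid_dedup; congr (_ && _); apply: eq_all => i; rewrite run_dedup.
Qed.

Definition incp n (p : nat -> nat) := forall i, i.+1 < n -> p i < p i.+1.

Lemma incp_lt n p i j : incp n p -> i < j -> j < n -> p i < p j.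
Proof.
move=> h; elim: j => // j IH; rewrite ltnS leq_eqVlt => /orP[/eqP ->|ij] hj.
  exact: h.
by apply: ltn_trans (h j hj); apply: IH => //; apply: ltnW.
Qed.

Lemma incp_inj n p i j : incp n p -> i < n -> j < n -> p i = p j -> i = j.
Proof.
move=> h hi hj e; case: (ltngtP i j) => // ij.
  by have := incp_lt h ij hj; lia.
by have := incp_lt h ij hi; lia.
Qed.

(** Particles could collide only if [a] and [a.+1] were both occupied, and such a letter is
    excluded. *)
Lemma incp_hop n p a : incp n p -> occ n p a != occ n p a.+1 ->
  incp n (fun i => hop a (p i)).
Proof.
move=> h ok i hi; have := h i hi; rewrite /hop.
case: eqP => e1; case: eqP => e2; try lia.
have o1 : occ n p a by apply/occP; exists i => //; apply: ltnW.
move: ok; rewrite o1; case: occP => // no _ lt.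
have : p i.+1 <> a.+1 by move=> e; apply: no; exists i.+1.
lia.
Qed.

Lemma incp_run n p u : incp n p -> valid n p u -> incp n (run p u).
Proof. by elim: u p => //= a u IH p h /andP[ok v]; apply: IH => //; apply: incp_hop. Qed.

Lemma run_ge p u i : p i <= run p u i.
Proof.
elim: u p => //= a u IH p; apply: leq_trans (IH _).
by rewrite /hop; case: eqP => [->|].
Qed.

Lemma sum_hop n p a : incp n p ->
  \sum_(i < n) hop a (p i) <= (\sum_(i < n) p i).+1.
Proof.
move=> h; case: (boolP (occ n p a)) => [/occP[i hi e]|no].
  rewrite (bigD1 (Ordinal hi)) //= [in X in _ <= X](bigD1 (Ordinal hi)) //=.
  rewrite /hop e eqxx addSn ltnS leq_add2l leq_eqVlt; apply/orP; left; apply/eqP.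
  apply: eq_bigr => j nj; case: eqP => // ej; case/eqP: nj; apply: val_inj.
  by apply: (incp_inj h) => //=; rewrite ej.
rewrite leq_eqVlt; apply/orP; right; rewrite ltnS leq_eqVlt; apply/orP; left.
apply/eqP/eq_bigr => j _; rewrite /hop; case: eqP => // e.
by move: no; have -> : occ n p a by apply/occP; exists j.
Qed.

Lemma sum_run n p u : incp n p -> valid n p u ->
  \sum_(i < n) run p u i <= \sum_(i < n) p i + size u.
Proof.
elim: u p => [|a u IH] p h /=; first by rewrite addn0.
case/andP => ok v; apply: leq_trans (IH _ _ v) _; first exact: incp_hop.
by rewrite addnS -addSn leq_add2r; apply: sum_hop.
Qed.

Lemma sum_nth_lam n lam : size lam <= n ->
  \sum_(i < n) nth 0 lam (n - i.+1) = sumn lam.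
Proof.
move=> h; rewrite (reindex_inj rev_ord_inj) /=.
rewrite (eq_bigr (fun i : 'I_n => nth 0 lam i)); last first.
  by move=> i _; congr nth; have := ltn_ord i; lia.
rewrite -(big_mkord xpredT (fun i => nth 0 lam i)).
rewrite (big_cat_nat (n := size lam)) //=.
have -> : \sum_(size lam <= i < n) nth 0 lam i = 0.
  by rewrite big_nat big1 // => i /andP[hi _]; rewrite nth_default.
by rewrite addn0 sumnE [RHS](big_nth 0).
Qed.

(** Each letter moves at most one particle by one step, so a word is no shorter than the total
    displacement. This keeps the truncated subtractions in the exponents of [beta] honest. *)
Lemma word_of_size n lam u : size lam <= n -> word_of n lam u ->
  sumn lam <= size u.
Proof.
move=> hl /andP[v /allP h].
have := sum_run (n := n) (p := id) (fun i _ => leqnn _) v.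
rewrite (eq_bigr (fun i : 'I_n => nth 0 lam (n - i.+1) + i)).
  by rewrite big_split /= sum_nth_lam // [X in _ <= X]addnC leq_add2r.
by move=> i _; apply/eqP/h; rewrite mem_iota add0n ltn_ord.
Qed.

(** * Demazure products of Grassmannian type *)

(* A permutation is paired with its inverse, which [lmul] uses to compare the
   positions of two values. *)
Definition bij2 (s : (nat -> nat) * (nat -> nat)) :=
  cancel s.1 s.2 /\ cancel s.2 s.1.

Definition rmul (a : nat) (s : (nat -> nat) * (nat -> nat)) :=
  if s.1 a < s.1 a.+1 then (s.1 \o swapn a, swapn a \o s.2) else s.

Definition lmul (a : nat) (s : (nat -> nat) * (nat -> nat)) :=
  if s.2 a < s.2 a.+1 then (swapn a \o s.1, s.2 \o swapn a) else s.

Lemma swapnK a : involutive (swapn a).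
Proof. by move=> i; rewrite /swapn; repeat case: eqP; lia. Qed.

Lemma swapn_lt a x y : ~~ ((x == a) && (y == a.+1)) ->
  ~~ ((x == a.+1) && (y == a)) -> (swapn a x < swapn a y) = (x < y).
Proof. rewrite /swapn; repeat case: eqP => ? //=; lia. Qed.

Lemma bij2_rmul a s : bij2 s -> bij2 (rmul a s).
Proof.
rewrite /rmul; case: ifP => // _ [h1 h2]; split => i /=.
  by rewrite h1 swapnK.
by rewrite swapnK h2.
Qed.

Lemma bij2_lmul a s : bij2 s -> bij2 (lmul a s).
Proof.
rewrite /lmul; case: ifP => // _ [h1 h2]; split => i /=.
  by rewrite swapnK h1.
by rewrite h2 swapnK.
Qed.

Lemma swapn_conj (f g : nat -> nat) a b : cancel f g ->
  f b = a -> f b.+1 = a.+1 -> f \o swapn b = swapn a \o f.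
Proof.
move=> fK e1 e2; apply: functional_extensionality => i /=.
have inj := can_inj fK.
rewrite {1}/swapn; case: eqP => [->|n1]; first by rewrite e1 e2 /swapn eqxx.
case: eqP => [->|n2]; first by rewrite e1 e2 /swapn; case: eqP; [lia|rewrite eqxx].
rewrite /swapn; case: eqP => [e|_]; first by case: n1; apply: inj; rewrite e1.
by case: eqP => [e|//]; case: n2; apply: inj; rewrite e2.
Qed.

(** Usually neither multiplication affects the comparison made by the other. Two cases are special:
    if [b], [b.+1] are sent to [a], [a.+1], both products are the same permutation and the second
    multiplication is absorbed; if they are sent there in reverse order, neither multiplication
    acts. *)
Lemma lmul_rmul a b s : bij2 s -> lmul a (rmul b s) = rmul b (lmul a s).
Proof.
case: s => w v [/= wK vK].
case: (boolP ((w b == a) && (w b.+1 == a.+1))) => [/andP[/eqP e1 /eqP e2]|n1].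
  have f1 : v a = b by rewrite -e1.
  have f2 : v a.+1 = b.+1 by rewrite -e2.
  rewrite /lmul /rmul /= e1 e2 f1 f2 !ltnSn /= e1 e2 f1 f2.
  have sw c : (swapn c c < swapn c c.+1) = false.
    by rewrite /swapn eqxx; case: eqP; [lia|rewrite eqxx; lia].
  by rewrite !sw (swapn_conj wK e1 e2) -(swapn_conj vK f1 f2).
case: (boolP ((w b == a.+1) && (w b.+1 == a))) => [/andP[/eqP e1 /eqP e2]|n2].
  have f1 : v a.+1 = b by rewrite -e1.
  have f2 : v a = b.+1 by rewrite -e2.
  have h c : (c.+1 < c) = false by lia.
  by rewrite /lmul /rmul /= e1 e2 f1 f2 !h /= e1 e2 f1 f2 !h.
have m1 : ~~ ((v a == b) && (v a.+1 == b.+1)).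
  by apply/andP => -[/eqP e1 /eqP e2]; case/negP: n1; rewrite -{1}e1 -e2 !vK !eqxx.
have m2 : ~~ ((v a == b.+1) && (v a.+1 == b)).
  by apply/andP => -[/eqP e1 /eqP e2]; case/negP: n2; rewrite -{1}e2 -e1 !vK !eqxx.
rewrite /lmul /rmul; case c1: (w b < w b.+1); case c2: (v a < v a.+1);
  by rewrite /= ?c1 ?c2 /= ?(swapn_lt n1 n2) ?(swapn_lt m1 m2) ?c1 ?c2.
Qed.

Lemma demazure_foldr u :
  demazure u = (foldr lmul (id, id) u).1.
Proof.
have -> : demazure u = (foldl (fun s a => rmul a s) (id, id) u).1.
  rewrite /demazure -[X in foldl _ X](erefl (id, id : nat -> nat).1).
  elim: u (id, id : nat -> nat) => //= a u IH s.
  by rewrite -IH /rmul; case: ifP.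
congr fst; elim: u => //= a u IH.
have cm s : bij2 s ->
    foldl (fun s a => rmul a s) (lmul a s) u = lmul a (foldl (fun s a => rmul a s) s u).
  elim: (u) s => //= b u' IHu s hs; rewrite -lmul_rmul // IHu //; exact: bij2_rmul.
by rewrite -IH -cm //; split.
Qed.

Definition lrun (s : (nat -> nat) * (nat -> nat)) (v : seq nat) :=
  foldl (fun s a => lmul a.+1 s) s v.

Lemma demazure_lrun v :
  demazure (rev [seq a.+1 | a <- v]) = (lrun (id, id) v).1.
Proof.
rewrite demazure_foldr; congr fst.
rewrite -(foldl_rev (fun s a => lmul a s)) revK /lrun.
by move: (id, id : nat -> nat); elim: v => //= a v IH s; apply: IH.
Qed.

Definition grassmannian n (p : nat -> nat) (s : (nat -> nat) * (nat -> nat)) :=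
  [/\ forall i, i < n -> s.1 i.+1 = (p i).+1, s.1 0 = 0, bij2 s &
      forall b, 0 < b -> b <> n -> s.1 b < s.1 b.+1].

Definition bad_descent n (s : (nat -> nat) * (nat -> nat)) :=
  [/\ s.1 0 = 0, bij2 s & exists b, [/\ 0 < b, b <> n & s.1 b.+1 < s.1 b]].

Lemma lmul0 a s : s.1 0 = 0 -> (lmul a.+1 s).1 0 = 0.
Proof. by rewrite /lmul; case: ifP => //= _ ->; rewrite /swapn. Qed.

(** Exchanging two consecutive values affects the order of two entries only if these are the entries
    with those values, and [lmul] exchanges them only when the smaller one stands on the left. *)
Lemma bad_descent_lmul n a s : bad_descent n s -> bad_descent n (lmul a.+1 s).
Proof.
move=> [h0 hb [b [b0 bn lt]]]; split; [exact: lmul0|exact: bij2_lmul|].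
exists b; split => //; rewrite /lmul; case: ifP => //= c.
case: hb => wK vK.
rewrite swapn_lt //; apply/andP => -[/eqP e1 /eqP e2].
  by move: c; rewrite -e2 -e1 !wK; lia.
by move: lt; rewrite e1 e2; lia.
Qed.

Lemma grass_inc n p s b c : grassmannian n p s -> 0 < b -> b < c ->
  (c <= n) || (n < b) -> s.1 b < s.1 c.
Proof.
move=> [_ _ _ h] b0; elim: c => // c IH; rewrite ltnS leq_eqVlt => /orP[/eqP <-|bc] hc.
  by apply: h => //; lia.
by apply: ltn_trans (h c _ _); [apply: IH; lia|lia|lia].
Qed.

Lemma grass_pos n p s a : grassmannian n p s -> 0 < s.2 a.+1.
Proof.
move=> [_ h0 [_ vK] _]; rewrite lt0n; apply/eqP => e.
by have := vK a.+1; rewrite e h0.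
Qed.

Lemma grass_occ n p s a : grassmannian n p s -> occ n p a = (s.2 a.+1 <= n).
Proof.
move=> g; have g0 := grass_pos a g; case: g => [h1 _ [wK vK] _].
apply/occP/idP => [[i hi e]|h]; first by rewrite -e -h1 // wK.
exists (s.2 a.+1).-1; first by lia.
by have := h1 (s.2 a.+1).-1; rewrite prednK // vK => /(_ h) [].
Qed.

(** If the smaller of the two values is among the first [n] entries, the exchange moves its
    particle. If the larger one is, the values already stand in decreasing order, the product
    absorbs the letter, and no particle hops. *)
Lemma grass_step n p s a : grassmannian n p s ->
  occ n p a != occ n p a.+1 ->
  grassmannian n (fun i => hop a (p i)) (lmul a.+1 s).
Proof.
move=> g; rewrite !(grass_occ _ g) => ok.
have [h1 h0 hb h2] := g; have [wK vK] := hb.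
split; [|exact: lmul0|exact: bij2_lmul|]; rewrite /lmul; case: ifP => c /=.
- move=> i hi; rewrite h1 // /swapn /hop eqSS; case: eqP => // _.
  case: eqP => // -[e].
  have : s.2 a.+2 = i.+1 by rewrite -e -h1 // wK.
  by lia.
- move=> i hi; rewrite h1 // /hop; case: eqP => // e.
  have : s.2 a.+1 = i.+1 by rewrite -e -h1 // wK.
  by lia.
- move=> b b0 bn; rewrite swapn_lt; first exact: h2.
    apply/andP => -[/eqP e1 /eqP e2]; move: ok; rewrite -e2 -e1 !wK; lia.
  by apply/andP => -[/eqP e1 /eqP e2]; have := h2 b b0 bn; rewrite e1 e2; lia.
- exact: h2.
Qed.

(** Entries increase on each side of [n], so consecutive values on the same side stand in adjacent
    positions. Exchanging them makes a descent away from [n]. *)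
Lemma grass_dead n p s a : grassmannian n p s ->
  ~~ (occ n p a != occ n p a.+1) -> bad_descent n (lmul a.+1 s).
Proof.
move=> g; rewrite negbK !(grass_occ _ g) => /eqP ok.
have [h1 h0 hb h2] := g; have [wK vK] := hb.
have p1 := grass_pos a g; have p2 := grass_pos a.+1 g.
have lt : s.2 a.+1 < s.2 a.+2.
  case: (ltngtP (s.2 a.+1) (s.2 a.+2)) => // h.
    by have := grass_inc g p2 h; rewrite !vK => hh; have := hh _; lia.
  by have := vK a.+1; rewrite h vK; lia.
have e : s.2 a.+2 = (s.2 a.+1).+1.
  case: (ltngtP (s.2 a.+2) (s.2 a.+1).+1) => // h; first by lia.
  have := @grass_inc _ _ _ (s.2 a.+1) (s.2 a.+1).+1 g p1 (ltnSn _).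
  have := grass_inc g (ltn0Sn _) h.
  by rewrite !vK => i1 i2; have := i1 _; have := i2 _; lia.
split; [exact: lmul0|exact: bij2_lmul|].
exists (s.2 a.+1); split => //; first by lia.
rewrite /lmul lt /= -e !vK /swapn eqxx; case: eqP; [lia|by rewrite eqxx].
Qed.

Lemma lrun_dead n s v : bad_descent n s -> bad_descent n (lrun s v).
Proof. by elim: v s => //= a v IH s h; apply: IH; apply: bad_descent_lmul. Qed.

Lemma lrun_valid n p s v : grassmannian n p s ->
  if valid n p v then grassmannian n (run p v) (lrun s v)
  else bad_descent n (lrun s v).
Proof.
elim: v p s => //= a v IH p s g; case: (boolP (_ != _)) => ok /=.
  by apply: IH; apply: grass_step.
by apply: lrun_dead; apply: grass_dead g ok.
Qed.

Lemma grass_id n : grassmannian n id (id, id).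
Proof. by split. Qed.

Lemma lrun_fix N s v : all (fun a => a.+1 < N) v ->
  (forall i, N < i -> s.1 i = i) -> forall i, N < i -> (lrun s v).1 i = i.
Proof.
elim: v s => //= a v IH s /andP[h1 h2] hs; apply: IH => // i hi.
rewrite /lmul; case: ifP => _ /=; rewrite hs // /swapn.
by case: eqP; [lia|case: eqP => //; lia].
Qed.

(** * Lehmer codes at records and at descents *)

Section Lehmer.
Variables (N : nat) (w v : nat -> nat).
Hypotheses (wK : cancel w v) (vK : cancel v w) (w0 : w 0 = 0).
Hypothesis wfix : forall i, N < i -> w i = i.

Lemma perm_range i : 0 < i -> i <= N -> 0 < w i <= N.
Proof.
move=> i0 iN; apply/andP; split.
  by rewrite lt0n; apply/eqP => e; have := wK i; rewrite e -w0 wK; lia.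
rewrite leqNgt; apply/negP => h; have := wfix h.
by move/(can_inj wK); lia.
Qed.

Lemma count_below i : 0 < i -> i <= N ->
  count (fun j => w j < w i) (iota 1 N) = (w i).-1.
Proof.
move=> i0 iN; have /andP[wi0 wiN] := perm_range i0 iN.
have -> : count (fun j => w j < w i) (iota 1 N) =
          count (fun x => x < w i) [seq w j | j <- iota 1 N] by rewrite count_map.
have pe : perm_eq [seq w j | j <- iota 1 N] (iota 1 N).
  apply: uniq_perm.
  - by rewrite map_inj_uniq ?iota_uniq //; apply: can_inj wK.
  - exact: iota_uniq.
  have sub : {subset [seq w j | j <- iota 1 N] <= iota 1 N}.
    move=> x /mapP[j]; rewrite !mem_iota => /andP[j0 j1] ->.
    by have := perm_range (i := j); lia.
  have := uniq_min_size (s1 := [seq w j | j <- iota 1 N]) (s2 := iota 1 N).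
  rewrite map_inj_uniq ?iota_uniq; last exact: can_inj wK.
  by rewrite size_map leqnn => /(_ isT sub isT)[].
rewrite (seq.permP pe).
have -> : N = (w i).-1 + (N - (w i).-1) by lia.
rewrite iotaD count_cat.
have -> : count (fun x => x < w i) (iota 1 (w i).-1) = (w i).-1.
  rewrite -[RHS](size_iota 1); apply/eqP; rewrite -all_count.
  by apply/allP => x; rewrite mem_iota; lia.
rewrite -[RHS]addn0; congr (_ + _); apply/eqP; rewrite -leqn0 leqNgt -has_count.
by apply/hasPn => x; rewrite mem_iota; lia.
Qed.

(** Of the [w i - 1] smaller values, the [i - 1] preceding entries account for their share, and the
    others come later. *)
Lemma lehmer_record i : 0 < i -> i <= N -> (forall j, 0 < j -> j < i -> w j < w i) ->
  lehmer N w i = w i - i.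
Proof.
move=> i0 iN h; have /andP[wi0 wiN] := perm_range i0 iN.
have := count_below i0 iN.
have {1}-> : N = i.-1 + (1 + (N - i)) by lia.
rewrite !iotaD !count_cat (_ : 1 + i.-1 = i); last by lia.
rewrite /= ltnn /lehmer addn1.
have -> : count (fun j => w j < w i) (iota 1 i.-1) = i.-1.
  rewrite -[RHS](size_iota 1); apply/eqP; rewrite -all_count.
  by apply/allP => x; rewrite mem_iota => /andP[x0 x1]; apply: h; lia.
by lia.
Qed.

Lemma lehmer_last i : (forall j, i < j -> w i < w j) -> lehmer N w i = 0.
Proof.
move=> h; apply/eqP; rewrite -leqn0 leqNgt -has_count.
apply/hasPn => x; rewrite mem_iota => /andP[x0 _]; have := h x x0; lia.
Qed.

Lemma lehmer_descent b : 0 < b -> w b.+1 < w b ->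
  b < N /\ lehmer N w b.+1 < lehmer N w b.
Proof.
move=> b0 lt; have bN : b < N.
  rewrite ltnNge; apply/negP => h; have := wfix (i := b.+1) h.
  case: (ltngtP N b) h => // [h|h] _ e.
    by move: lt; rewrite e wfix //; lia.
  by have := perm_range b0; rewrite h; lia.
split=> //; rewrite /lehmer (_ : N - b = (N - b.+1).+1) /=; last by lia.
rewrite lt add1n ltnS; apply: sub_count => j /=; lia.
Qed.
End Lehmer.

(** For a Grassmannian permutation the first [n] entries are records, whose code is the distance
    travelled, and no later entry has a smaller one behind it. A bad descent makes the code drop
    strictly at a place other than [n]; [grass_code] cannot do that, being weakly increasing up to
    [n] and zero afterwards. *)
Lemma lehmer_code_word_of n N lam v :
  is_partition lam -> size lam <= n -> n <= N ->
  all (fun a => a.+1 < N) v ->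
  [forall i : 'I_N, lehmer N (demazure (rev [seq a.+1 | a <- v])) i.+1
                     == grass_code n lam i.+1] = word_of n lam v.
Proof.
move=> /andP[srt _] sl nN hv; rewrite demazure_lrun.
have lamS i : nth 0 lam i.+1 <= nth 0 lam i.
  case: (ltnP i.+1 (size lam)) => h; last by rewrite (nth_default _ h).
  exact: (sortedP 0 srt).
have := lrun_valid v (grass_id n); rewrite /word_of.
have := lrun_fix (s := (id, id)) hv (fun _ _ => erefl).
case: (lrun _ _) => w u /= fixN; case: ifP => val /=.
  move=> g; have [h1 w0 [wK vK] h2] := g; rewrite /= in h1 w0 wK vK h2.
  apply/forallP/allP => [h i|h i].
    rewrite mem_iota add0n => /= hi.
    have iN : i < N by lia.
    have /eqP := h (Ordinal iN).
    rewrite (lehmer_record wK w0 fixN) //=; last first.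
      by move=> j j0 ji; apply: (grass_inc g) => //=; rewrite hi.
    rewrite h1 // /grass_code /= hi => e.
    by have := run_ge id v i; rewrite /=; lia.
  rewrite /grass_code /=; case: ltnP => hi.
    rewrite (lehmer_record wK w0 fixN) //=; last first.
      by move=> j j0 ji; apply: (grass_inc g) => //=; rewrite hi.
    have := h i; rewrite mem_iota add0n hi => /(_ isT) /eqP e.
    by rewrite h1 // e; lia.
  rewrite lehmer_last // => j ij; apply: (grass_inc g) => //=.
  by rewrite ltnS hi orbT.
move=> [w0 [wK vK] [b [b0 bn lt]]]; rewrite /= in w0 wK vK lt.
apply/forallP => h.
have [bN] := lehmer_descent wK w0 fixN b0 lt.
have := h (Ordinal bN); rewrite /= => /eqP ->.
have b1 : b.-1 < N by lia.
have := h (Ordinal b1); rewrite /= prednK // => /eqP ->.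
rewrite /grass_code b0 /=; case: (ltnP b n) => hb.
  rewrite (ltnW hb); have := lamS (n - b.+1).
  have -> : (n - b.+1).+1 = n - b by lia.
  by lia.
by have -> : (b <= n) = false by lia.
Qed.

(** * Generating functions of words and of kompositions *)

Section Rows.
Variable M : nat.
Implicit Types A : {set 'I_M}.

Definition srow A : seq nat := [seq val a | a <- enum A].

Definition rows (D : seq {set 'I_M}) : seq (seq nat) := [seq srow A | A <- D].

Lemma mem_srow A (a : 'I_M) : (val a \in srow A) = (a \in A).
Proof. by rewrite mem_map ?mem_enum //; apply: val_inj. Qed.

Lemma srow_lt A x : x \in srow A -> x < M.
Proof. by case/mapP => a _ ->; apply: ltn_ord. Qed.

Lemma srow_sorted A : sorted ltn (srow A).
Proof.
have -> : srow A = [seq val a | a <- [seq a <- enum 'I_M | a \in A]].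
  by rewrite /srow {1}/enum_mem -enumT.
rewrite sorted_map; apply: sorted_filter; first by move=> x y z /=; apply: ltn_trans.
by have := iota_ltn_sorted 0 M; rewrite -val_enum_ord sorted_map.
Qed.

Lemma rows_sorted D : all (sorted ltn) (rows D).
Proof. by apply/allP => s /mapP[A _ ->]; apply: srow_sorted. Qed.

Lemma srow_inj : injective srow.
Proof. by move=> A B e; apply/setP => a; rewrite -!mem_srow e. Qed.

Lemma srow_onto s : sorted ltn s -> all (fun x => x < M) s ->
  exists A, srow A = s.
Proof.
move=> ss hs; exists [set a : 'I_M | val a \in s].
apply: (irr_sorted_eq ltn_trans ltnn) => //; first exact: srow_sorted.
move=> x; apply/idP/idP => [h|h].
  by have := srow_lt h => hx; move: h; rewrite (mem_srow _ (Ordinal hx)) inE.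
have hx : x < M by have := allP hs _ h.
by rewrite (mem_srow _ (Ordinal hx)) inE.
Qed.

Lemma flatten_rows_lt D : all (fun x => x < M) (flatten (rows D)).
Proof.
by elim: D => //= A D IH; rewrite all_cat IH andbT; apply/allP => x; apply: srow_lt.
Qed.

Lemma rows_onto n (ds : seq (seq nat)) : size ds = n ->
  all (sorted ltn) ds -> all (fun x => x < M) (flatten ds) ->
  exists D : n.-tuple {set 'I_M}, rows D = ds.
Proof.
elim: n ds => [|n IH] [|d ds] //; first by exists [tuple].
rewrite [size _]/= [all _ _]/= [flatten _]/= all_cat.
move=> [hn] /andP[h1 h2] /andP[h3 h4].
have [D e] := IH ds hn h2 h4; have [A eA] := srow_onto h1 h3.
by exists [tuple of A :: D]; rewrite /= /rows /= -/(rows D) eA e.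
Qed.

Lemma rows_inj n (D D' : n.-tuple {set 'I_M}) : rows D = rows D' -> D = D'.
Proof. by move/(inj_map srow_inj) => e; apply: val_inj. Qed.
End Rows.

(** * Recursions for words and for kompositions *)

Section GeneratingFunctions.
Local Open Scope ring_scope.

Lemma big_tuple_cons (R : nmodType) (T : finType) n (P : pred (seq T)) (F : seq T -> R) :
  \sum_(t : n.+1.-tuple T | P t) F t =
  \sum_a \sum_(t : n.-tuple T | P (a :: t)) F (a :: t).
Proof.
rewrite pair_big_dep /=.
rewrite (reindex (fun p : T * n.-tuple T => [tuple of p.1 :: p.2])) /=.
  exact: eq_bigr.
exists (fun t => (thead t, [tuple of behead t])) => [[a t] _|t _] /=.
  by congr pair; apply: val_inj.
by rewrite [RHS]tuple_eta.
Qed.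

Lemma big_tuple0 (R : nmodType) (T : finType) (P : pred (seq T)) (F : seq T -> R) :
  \sum_(t : 0.-tuple T | P t) F t = if P [::] then F [::] else 0.
Proof.
case: ifP => h.
  by rewrite (big_pred1 [tuple]) // => t; rewrite tuple0 h [RHS]eqxx.
by rewrite big_pred0 // => t; rewrite tuple0.
Qed.

(* Recognizes the kompositions, read from their last entry, that are glides of
   an [a] whose nonzero entries, read from the last one, are [c]: the head of
   [c] is the part of the current block that remains to be filled. *)
Fixpoint glide_rec (c : seq nat) (bs : seq (nat * bool)) : bool :=
  if bs is (b, r) :: bs' then
    (b <= head 0%N c)%N &&
    if r then (0 < b)%N && glide_rec ((head 0 c - b).+1 :: behead c)%N bs'
    else glide_rec (cons_pos (head 0%N c - b) (behead c)) bs'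
  else c == [::].

Section Sums.
Variables (R : comPzRingType) (beta : R) (x : nat -> R).

Fixpoint komp_mon (bs : seq (nat * bool)) : R :=
  if bs is (b, r) :: bs' then
    beta ^+ r * x (size bs').+1 ^+ b * komp_mon bs'
  else 1.

(** Row [v] comes from row [n - v] of the pipe dream, counted from 1, so the head of the list
    carries the variable of largest index. *)
Fixpoint rows_mon (ds : seq (seq nat)) : R :=
  if ds is d :: ds' then x (size ds').+1 ^+ size d * rows_mon ds' else 1.

Definition word_sum M n (e : seq nat) : R :=
  \sum_(D : n.-tuple {set 'I_M} | dedup (flatten (rows D)) == e)
    beta ^+ (size (flatten (rows D)) - size e) * rows_mon (rows D).

Definition kpair Bd (b : 'I_Bd * bool) : nat * bool := (val b.1, b.2).

Definition komp_sum Bd n (c : seq nat) : R :=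
  \sum_(B : n.-tuple ('I_Bd * bool) | glide_rec c (map (@kpair Bd) B))
    komp_mon (map (@kpair Bd) B).

Lemma word_sum0 M e : word_sum M 0 e = (e == [::])%:R.
Proof.
rewrite /word_sum (big_tuple0 (fun D => dedup (flatten (rows D)) == e)
  (fun D => beta ^+ (size (flatten (rows D)) - size e) * rows_mon (rows D))) /=.
by rewrite eq_sym sub0n expr0 mul1r; case: eqP.
Qed.

Lemma komp_sum0 Bd c : komp_sum Bd 0 c = (c == [::])%:R.
Proof.
rewrite /komp_sum (big_tuple0 (fun B => glide_rec c (map (@kpair Bd) B))
  (fun B => komp_mon (map (@kpair Bd) B))) /=.
by case: eqP.
Qed.

Lemma komp_sumS Bd n c : (head 0 c < Bd)%N ->
  komp_sum Bd n.+1 c =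
  \sum_(b < Bd | (b <= head 0 c)%N) x n.+1 ^+ b *
    (komp_sum Bd n (cons_pos (head 0 c - b) (behead c))%N +
     (if (0 < b)%N then beta * komp_sum Bd n ((head 0 c - b).+1 :: behead c)%N else 0)).
Proof.
move=> hB; rewrite /komp_sum (big_tuple_cons _ (fun B => glide_rec c (map (@kpair Bd) B))
  (fun B => komp_mon (map (@kpair Bd) B))) /=.
rewrite -(pair_bigA _ (fun (b : 'I_Bd) (r : bool) => \sum_(t : n.-tuple ('I_Bd * bool) |
  (b <= head 0 c)%N && (if r then (0 < b)%N && glide_rec ((head 0 c - b).+1 :: behead c)%N (map (@kpair Bd) t)
    else glide_rec (cons_pos (head 0%N c - b) (behead c)) (map (@kpair Bd) t)))
  (beta ^+ r * x (size (map (@kpair Bd) t)).+1 ^+ b * komp_mon (map (@kpair Bd) t)))) /=.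
rewrite [RHS]big_mkcond /=; apply: eq_bigr => b _.
rewrite big_bool /=; case: (b <= head 0 c)%N => /=; last by rewrite !big_pred0_eq addr0.
rewrite addrC mulrDr !mulr_sumr; congr (_ + _).
  by apply: eq_bigr => t _; rewrite size_map size_tuple expr0 mul1r.
case: (0 < b)%N => /=; last by rewrite big_pred0_eq mulr0.
rewrite !mulr_sumr; apply: eq_bigr => t _.
by rewrite size_map size_tuple expr1 !mulrA [beta * _]mulrC.
Qed.

(** Here [b] is the length of the first row. In the second summand its last letter is repeated at
    the start of the rest, and this one surplus letter gives [beta]. *)
Lemma word_sumS M Bd n e : nadj e -> all (fun y => (y < M)%N) e ->
  (size e < Bd)%N ->
  word_sum M n.+1 e =
  \sum_(b < Bd | (b <= head 0 (run_lengths e))%N) x n.+1 ^+ b *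
    (word_sum M n (drop b e) +
     (if (0 < b)%N then beta * word_sum M n (drop b.-1 e) else 0)).
Proof.
move=> ne he hB; rewrite /word_sum.
rewrite (big_tuple_cons _ (fun D => dedup (flatten (rows D)) == e)
  (fun D => beta ^+ (size (flatten (rows D)) - size e) * rows_mon (rows D))) /=.
pose G b : R := x n.+1 ^+ b *
    (word_sum M n (drop b e) +
     (if (0 < b)%N then beta * word_sum M n (drop b.-1 e) else 0)).
(* For a fixed first row only [b = size (srow A)] can contribute; writing this term as a sum over
   [b] prepares the exchange of summations. *)
have inner (A : {set 'I_M}) : \sum_(t : n.-tuple {set 'I_M} | dedup (srow A ++ flatten (rows t)) == e)
     beta ^+ (size (srow A ++ flatten (rows t)) - size e) *
     (x (size (rows t)).+1 ^+ size (srow A) * rows_mon (rows t)) =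
   \sum_(b < Bd | (b <= size e)%N && (srow A == take b e)) G b.
  have sA := srow_sorted A.
  case: (boolP (srow A == take (size (srow A)) e)) => hA; last first.
    rewrite big_pred0; last by move=> t; rewrite dedup_cat_eq // (negbTE hA).
    rewrite big_pred0 // => b; apply/andP => -[be /eqP eA].
    by move: hA; rewrite eA size_take_min (minn_idPl be) eqxx.
  have hAs : (size (srow A) <= size e)%N by rewrite (eqP hA) size_take_min; lia.
  have hAB : (size (srow A) < Bd)%N by lia.
  rewrite [RHS](big_pred1 (Ordinal hAB)); last first.
    move=> b; apply/andP/eqP => [[be /eqP eA]|->]; last by rewrite /= hAs.
    by apply: val_inj; rewrite /= eA size_take_min (minn_idPl be).
  rewrite /= /G; set k := size (srow A) in hA hAs hAB *.
  rewrite (eq_bigl (fun t : n.-tuple {set 'I_M} => (dedup (flatten (rows t)) == drop k e)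
     || ((0 < k)%N && (dedup (flatten (rows t)) == drop k.-1 e)))); last first.
    by move=> t; rewrite dedup_cat_eq // -/k hA.
  rewrite (bigID (fun t : n.-tuple {set 'I_M} => dedup (flatten (rows t)) == drop k e)) /=.
  rewrite mulrDr /word_sum !mulr_sumr; congr (_ + _).
    apply: eq_big => [t|t /andP[_ /eqP ht]]; first by case: (dedup _ == _); rewrite ?andbF.
    rewrite size_map size_tuple size_cat -/k size_drop mulrCA; congr (_ * (beta ^+ _ * _)).
    lia.
  case: (posnP k) => [k0|k0].
    by rewrite mulr0 big_pred0 // => t; case: (dedup _ == _).
  rewrite !mulr_sumr; apply: eq_big => [t|t /andP[/orP[->//|/= /eqP ht] _]].
    case: eqP => /= [e1|_]; last by rewrite andbT.
    (* The two alternatives exclude each other because the two suffixes of [e] differ in length. *)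
    apply/esym/eqP => e2; have := congr1 size (etrans (esym e1) e2).
    by rewrite !size_drop; lia.
  have hs := size_dedup (flatten (rows t)); rewrite ht size_drop in hs.
  rewrite size_map size_tuple size_cat -/k size_drop mulrCA; congr (_ * _).
  rewrite mulrA -exprS; congr (beta ^+ _ * _); lia.
rewrite (eq_bigr _ (fun A _ => inner A)) (exchange_big_dep (fun b : 'I_Bd => (b <= size e)%N)) /=; last first.
  by move=> A b _ /andP[].
rewrite big_mkcond [RHS]big_mkcond; apply: eq_bigr => b _ /=.
have <- := sorted_take_run_lengths b e; case: (b <= size e)%N => //=.
have sz : all (fun y => (y < M)%N) (take b e) by apply/allP => y /mem_take /(allP he).
case: ifP => hs.
  have [A eA] := srow_onto hs sz; rewrite (big_pred1 A) // => A'; rewrite -eA; apply/eqP/eqP => [|->] //.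
  exact: srow_inj.
by rewrite big_pred0 // => A; apply/eqP => eA; move: hs; rewrite -eA srow_sorted.
Qed.

(** Dropping [b] letters shortens the first run by [b], and dropping [b - 1] leaves it nonempty:
    these are the continuations in [glide_rec] after a black and after a red entry. *)
Lemma word_sum_komp M Bd n e : nadj e -> all (fun y => (y < M)%N) e ->
  (size e < Bd)%N -> word_sum M n e = komp_sum Bd n (run_lengths e).
Proof.
elim: n e => [|n IH] e ne he hB.
  by rewrite word_sum0 komp_sum0 run_lengths_nil.
rewrite (word_sumS _ ne he hB) komp_sumS; last exact: leq_ltn_trans (head_run_lengths_size e) _.
have nd k : nadj (drop k e).
  by rewrite -(cat_take_drop k e) in ne; case: (cat_sorted2 ne).
have hd k : all (fun y => (y < M)%N) (drop k e) by apply/allP => y /mem_drop /(allP he).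
have sd k : (size (drop k e) < Bd)%N by rewrite size_drop; lia.
apply: eq_bigr => b hb; rewrite IH // run_lengths_drop //; congr (_ * (_ + _)).
case: posnP => // b0; rewrite IH // run_lengths_drop; last by lia.
rewrite /cons_pos; case: eqP => [|_]; first by lia.
by congr (_ * komp_sum _ _ (_ :: _)); lia.
Qed.

End Sums.
End GeneratingFunctions.

(** * Glides *)

Section Glide.
Variable B : nat -> nat * bool.
Hypothesis red_pos : forall k, (B k).2 -> 0 < (B k).1.

Definition first_black (i j : nat) : Prop :=
  forall k, i <= k < j -> (B k).1 != 0 ->
    (forall k', i <= k' < k -> (B k').1 = 0) -> ~~ (B k).2.

Definition block (y i j : nat) : Prop :=
  \sum_(i <= k < j) (B k).1 = y + \sum_(i <= k < j) (B k).2 /\ first_black i j.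

(* [c] lists the block totals from the last block to the first one. *)
Fixpoint blocks (c : seq nat) (j : nat) : Prop :=
  if c is y :: c' then exists i, [/\ i < j, block y i j & blocks c' i]
  else j = 0.

Definition glides (c : seq nat) (n : nat) : Prop :=
  exists j, [/\ j <= n, blocks c j & forall k, j <= k < n -> (B k).1 = 0].

Lemma sum_red_le i j : \sum_(i <= k < j) (B k).2 <= \sum_(i <= k < j) (B k).1.
Proof. by apply: leq_sum => k _; have := @red_pos k; case: (B k).2 => // ->. Qed.

Lemma sum_eq0 i j : \sum_(i <= k < j) (B k).1 = 0 ->
  forall k, i <= k < j -> (B k).1 = 0.
Proof.
move=> + k /andP[ik kj]; rewrite (big_cat_nat ik (ltnW kj)) /=.
by rewrite [X in _ + X]big_ltn //; lia.
Qed.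

Lemma sum_all0 i j : (forall k, i <= k < j -> (B k).1 = 0) ->
  (\sum_(i <= k < j) (B k).1 = 0) /\ (\sum_(i <= k < j) (B k).2 = 0).
Proof.
move=> h; split; rewrite big_nat big1 // => k hk.
by have := @red_pos k; rewrite (h k hk); case: (B k).2 => // /(_ isT).
Qed.

(** Every red entry adds at least one to the total, and the first nonzero entry adds to it without
    being red. *)
Lemma sum_red_lt i j : first_black i j ->
  0 < \sum_(i <= k < j) (B k).1 ->
  \sum_(i <= k < j) (B k).2 < \sum_(i <= k < j) (B k).1.
Proof.
elim: j => [|j IH] fb; first by rewrite big_geq.
case: (leqP i j) => ij; last by rewrite big_geq.
rewrite !big_nat_recr //=.
have fbj : first_black i j by move=> k /andP[h1 h2]; apply: fb; rewrite h1 ltnW.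
have rj : (B j).2 <= (B j).1 by have := @red_pos j; case: (B j).2 => // ->.
case: (posnP (\sum_(i <= k < j) (B k).1)) => [z|p].
  have z' := sum_eq0 z; have [_ ->] := sum_all0 z'.
  rewrite z !add0n => hj; have := fb j; rewrite ij ltnSn -lt0n => /(_ isT hj z').
  by case: (B j).2 hj.
by have := IH fbj p; lia.
Qed.

(** A final zero may lie in the last block or behind it. It can be cut off from the block, which
    stays nonempty because its total is positive. *)
Lemma glide_step_zero c n : all (fun y => 0 < y) c -> (B n).1 = 0 ->
  glides c n.+1 <-> glides c n.
Proof.
move=> c0 bn; have rn : (B n).2 = false.
  by have := @red_pos n; rewrite bn; case: (B n).2 => // /(_ isT).
split=> [[j [jn hc z]]|[j [jn hc z]]]; last first.
  exists j; split=> // [|k /andP[h1]]; first exact: leqW.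
  by rewrite ltnS leq_eqVlt => /orP[/eqP ->//|h2]; apply: z; rewrite h1.
case: (ltngtP j n.+1) jn => // [jn _|ej _].
  exists j; split=> // k /andP[h1 h2]; apply: z; rewrite h1; exact: ltnW.
case: c hc c0 => [/=|y c /= [i [ij [hs fb] hc]] /andP[y0 _]]; first by rewrite ej.
rewrite ej in ij hs fb.
have hs' : \sum_(i <= k < n) (B k).1 = y + \sum_(i <= k < n) (B k).2.
  by move: hs; rewrite !big_nat_recr //= bn rn !addn0.
exists n; split=> // [|k]; last by lia.
exists i; split=> //.
  by rewrite ltn_neqAle -ltnS ij andbT; apply/eqP => e; move: hs'; rewrite e !big_geq //; lia.
by split=> // k /andP[h1 h2]; apply: fb; rewrite h1 ltnW.
Qed.

Lemma blocks_end c n : (B n).1 != 0 -> glides c n.+1 -> blocks c n.+1.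
Proof.
move=> bn [j [jn hc z]]; suff <- : j = n.+1 by [].
apply/eqP; rewrite eqn_leq jn /= ltnNge; apply/negP => h.
by move: bn; rewrite z ?h ?ltnSn.
Qed.

(** Positivity of [y] provides a nonzero entry before [j], so the new last entry is not the first
    nonzero one and may have either colour. The zeros in between join the block. *)
Lemma block_extend y i j n r : i < j -> j <= n -> 0 < y -> block y i j ->
  (forall k, j <= k < n -> (B k).1 = 0) -> (B n).2 = r ->
  block (y + (B n).1 - r) i n.+1.
Proof.
move=> ij jn y0 [hs fb] z er; have [z1 z2] := sum_all0 z.
have rj : (B n).2 <= (B n).1 by have := @red_pos n; case: (B n).2 => // ->.
split=> [|k /andP[h1 h2] nz hk].
  rewrite !big_nat_recr /=; try lia.
  rewrite !(@big_cat_nat _ _ _ j i n) /= ?z1 ?z2 ?hs; lia.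
case: (ltnP k j) => kj; first by apply: fb => //; rewrite h1.
have [z3 z4] : (\sum_(i <= k < j) (B k).1 = 0) /\ (\sum_(i <= k < j) (B k).2 = 0).
  by apply: sum_all0 => k' /andP[h3 h4]; apply: hk; rewrite h3 /=; lia.
by move: hs; rewrite z3 z4; lia.
Qed.

(** A red entry counts for one less than its value and cannot open a block, so a positive amount,
    the [.+1], is left to the earlier entries of the block. *)
Lemma glide_step_red c n : (B n).2 ->
  glides c n.+1 <->
  ((B n).1 <= head 0 c) && (0 < (B n).1) /\
  glides ((head 0 c - (B n).1).+1 :: behead c) n.
Proof.
move=> rn; have b0 := red_pos rn.
split=> [g|[/andP[hb _] [j [jn [i [ij hs hc]] z]]]]; last first.
  exists n.+1; split=> // [|k]; last by lia.
  case: c hb hs hc => [/=|y c /= hb hs hc]; first by lia.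
  exists i; split=> //; first by lia.
  have := block_extend ij jn (ltn0Sn _) hs z rn.
  by congr block; lia.
have := blocks_end _ g; rewrite -lt0n => /(_ b0).
case: c {g} => // y c /= [i [ij [hs fb] hc]]; rewrite ltnS in ij.
have := hs; rewrite !big_nat_recr //= rn.
have fb' : first_black i n by move=> k /andP[h1 h2]; apply: fb; rewrite h1 ltnW.
have pos : 0 < \sum_(i <= k < n) (B k).1.
  rewrite lt0n; apply/eqP => /sum_eq0 z.
  by have := fb n; rewrite ij ltnSn -lt0n rn => /(_ isT b0 z).
have lt := sum_red_lt fb' pos => e.
split; first by apply/andP; split=> //; lia.
exists n; split=> // [|k]; last by lia.
exists i; split=> //; last by split=> //; lia.
rewrite ltn_neqAle ij andbT; apply/eqP => ein; by move: pos; rewrite ein big_geq.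
Qed.

(** When a black entry completes its block, the total of the rest equals its number of red entries,
    so the rest vanishes by [sum_red_lt]; its zeros become trailing zeros of the remaining
    entries. *)
Lemma glide_step_black c n : (B n).2 = false -> 0 < (B n).1 ->
  all (fun y => 0 < y) c ->
  glides c n.+1 <->
  ((B n).1 <= head 0 c) /\ glides (cons_pos (head 0 c - (B n).1) (behead c)) n.
Proof.
move=> rn b0 c0; split=> [g|[hb]].
  have := blocks_end _ g; rewrite -lt0n => /(_ b0).
  case: c {g c0} => // y c /= [i [ij [hs fb] hc]]; rewrite ltnS in ij.
  have := hs; rewrite !big_nat_recr //= rn addn0 => e.
  have fb' : first_black i n by move=> k /andP[h1 h2]; apply: fb; rewrite h1 ltnW.
  have le := sum_red_le i n; split; first by lia.
  rewrite /cons_pos; case: eqP => hy.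
    exists i; split=> //; apply: sum_eq0; apply/eqP; rewrite -leqn0 leqNgt.
    by apply/negP => /(sum_red_lt fb'); lia.
  exists n; split=> // [|k]; last by lia.
  exists i; split=> //; last by split=> //; lia.
  rewrite ltn_neqAle ij andbT; apply/eqP => ein.
  by move: e hy; rewrite ein !big_geq //; lia.
case: c c0 hb => [|y c] /=; first by lia.
move=> /andP[y0 _] hb; rewrite /cons_pos; case: eqP => hy [j [jn hc z]].
  exists n.+1; split=> // [|k]; last by lia.
  exists j; split=> //.
  have [z1 z2] := sum_all0 z; split.
    by rewrite !big_nat_recr //= z1 z2 rn; lia.
  move=> k /andP[h1 h2] nz hk; move: h2; rewrite ltnS leq_eqVlt => /orP[/eqP ->|h2].
    by rewrite rn.
  by move: nz; rewrite (z k) ?h1.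
case: hc => i [ij hs hc].
exists n.+1; split=> // [|k]; last by lia.
exists i; split=> //; first by lia.
have y1 : 0 < y - (B n).1 by lia.
have := block_extend ij jn y1 hs z rn.
by congr block; rewrite subn0; lia.
Qed.

Lemma cons_pos_gt0 y c : all (fun y => 0 < y) c -> all (fun y => 0 < y) (cons_pos y c).
Proof. by rewrite /cons_pos; case: eqP => //= /eqP; rewrite -lt0n => ->. Qed.

Lemma glides_rec n c : all (fun y => 0 < y) c ->
  glides c n <-> glide_rec c [seq B (n - k.+1) | k <- iota 0 n].
Proof.
elim: n c => [|n IH] c c0.
  split=> [[j [j0 hc _]]|/eqP ->]; last by exists 0.
  by case: c hc c0 => //= y c [i []]; lia.
rewrite /= subSS subn0 -[1]addn0 iotaDl -map_comp.
rewrite (eq_map (g := fun k => B (n - k.+1))); last by move=> k /=; rewrite subSS.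
have cb : all (fun y => 0 < y) (behead c) by case: (c) c0 => //= y c' /andP[].
case e: (B n) => [b r].
case: r e => e.
  rewrite (glide_step_red _ (n := n)) e //= IH //=.
  split=> [[/andP[h1 h2] h3]|/and3P[h1 h2 h3]]; first by rewrite h1 h2.
  by rewrite h1 h2.
case: (posnP b) => [b0|b0].
  rewrite glide_step_zero ?e //= b0 subn0 leq0n /=.
  have -> : cons_pos (head 0 c) (behead c) = c.
    by case: (c) c0 => //= y c' /andP[y0 _]; rewrite /cons_pos; case: eqP y0 => // ->.
  exact: IH.
rewrite glide_step_black ?e //= IH; last exact: cons_pos_gt0.
by split=> [[-> ->]|/andP[-> ->]].
Qed.

Lemma blocksP c j : blocks c j <->
  exists s : seq nat, [/\ size s = size c, last 0 s = j &
    forall t, t < size c -> nth 0 (0 :: s) t < nth 0 (0 :: s) t.+1 /\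
      block (nth 0 (rev c) t) (nth 0 (0 :: s) t) (nth 0 (0 :: s) t.+1)].
Proof.
elim: c j => [|y c IH] j /=.
  by split=> [->|[s [/eqP/nilP -> <- _]]] //; exists [::].
split=> [[i [ij hb /IH[s [ss ls hs]]]]|[s [ss ls hs]]].
  exists (rcons s j); rewrite size_rcons last_rcons ss; split=> // t.
  rewrite ltnS leq_eqVlt rev_cons -rcons_cons !nth_rcons /= size_rev ss !ltnS.
  case/orP => [/eqP ->|tc].
    rewrite leqnn ltnn eqxx.
    have -> : nth 0 (0 :: s) (size c) = i by rewrite -ss nth_last -ls; case: (s).
    by [].
  rewrite tc (ltnW tc) -[nth 0 s t]/(nth 0 (0 :: s) t.+1); exact: hs.
case/lastP: s ss ls hs => // s j'; rewrite size_rcons last_rcons => -[ss] -> hs.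
exists (last 0 s).
have hn : nth 0 (0 :: s) (size c) = last 0 s by rewrite -ss nth_last; case: (s).
have hj : nth 0 (rcons s j) (size c) = j by rewrite nth_rcons ss ltnn eqxx.
have hn' t : t <= size c -> nth 0 (0 :: rcons s j) t = nth 0 (0 :: s) t.
  by rewrite -rcons_cons nth_rcons /= ss ltnS => ->.
have hn2 t : t < size c -> nth 0 (rcons s j) t = nth 0 s t.
  by rewrite nth_rcons ss => ->.
split.
- by have [] := hs (size c) (ltnSn _); rewrite hj hn' // hn.
- have [_] := hs (size c) (ltnSn _).
  by rewrite hj hn' // hn rev_cons nth_rcons size_rev ltnn eqxx.
- apply/IH; exists s; split=> // t tc.
  have := hs t (leqW tc); rewrite hn2 // hn'; last exact: ltnW.
  by rewrite rev_cons nth_rcons size_rev tc.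
Qed.
End Glide.

Definition ext_komp (a : seq nat) (b : kompT a) (k : nat) : nat * bool :=
  if insub k is Some k' then (val (b k').1, (b k').2) else (0, false).

Lemma ext_kompE a (b : kompT a) (k : 'I_(size a)) :
  ext_komp b k = (val (b k).1, (b k).2).
Proof. by rewrite /ext_komp insubT /= => [|p]; [exact: ltn_ord|congr (val (b _).1, (b _).2); apply: val_inj]. Qed.

Lemma big_ord_range n i j (F : nat -> nat) : j <= n ->
  \sum_(k < n | i <= k < j) F k = \sum_(i <= k < j) F k.
Proof.
move=> jn; rewrite -(big_mkord (fun k => i <= k < j) F) (big_nat_widen i j n) //.
by rewrite (big_nat_widenl i 0) //; apply: eq_bigl => k; rewrite /= andbC.
Qed.

Lemma card_red_range a (b : kompT a) i j : j <= size a ->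
  #|[set k : 'I_(size a) | (i <= val k < j) && (b k).2]| =
  \sum_(i <= k < j) (ext_komp b k).2.
Proof.
move=> jn; rewrite -(big_ord_range _ _ jn) cardsE -sum1_card [LHS]big_mkcondr /=.
by apply: eq_bigr => k _; rewrite ext_kompE /=; case: (b k).2.
Qed.

Lemma sum_range a (b : kompT a) i j : j <= size a ->
  \sum_(k < size a | i <= val k < j) val (b k).1 =
  \sum_(i <= k < j) (ext_komp b k).1.
Proof.
by move=> jn; rewrite -(big_ord_range _ _ jn); apply: eq_bigr => k _; rewrite ext_kompE.
Qed.

(** * Glides of a composition whose zeros come first *)

Section IsGlide.
Variables (a c : seq nat).
Hypotheses (c_gt0 : all (fun y => 0 < y) c)
           (rev_a : rev a = c ++ nseq (size a - size c) 0).

Let n := size a.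
Let l := size c.

Lemma size_c_le : l <= n.
Proof. have := congr1 size rev_a; rewrite size_rev size_cat size_nseq -/n -/l; lia. Qed.

Lemma a_eq : a = nseq (n - l) 0 ++ rev c.
Proof. by rewrite -[LHS]revK rev_a rev_cat rev_nseq. Qed.

Lemma nth_a_pos j : nth 0 a (n - l + j) = nth 0 (rev c) j.
Proof. by rewrite {1}a_eq nth_cat size_nseq ltnNge leq_addr /= addKn. Qed.

Lemma glide_pos : [seq k <- iota 0 n | nth 0 a k != 0] = iota (n - l) l.
Proof.
have e : n = n - l + l by have := size_c_le; lia.
rewrite {1}e iotaD filter_cat add0n.
rewrite (_ : filter _ (iota 0 (n - l)) = [::]) /=.
  apply/all_filterP/allP => k; rewrite mem_iota => /andP[k1 k2].
  have -> : k = n - l + (k - (n - l)) by lia.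
  rewrite nth_a_pos -lt0n; apply: (allP c_gt0); rewrite -mem_rev; apply: mem_nth.
  by rewrite size_rev -/l; lia.
apply/eqP; rewrite -(negbK (_ == _)) -has_filter; apply/hasPn => k.
rewrite mem_iota => /andP[_ hk]; rewrite negbK {1}a_eq nth_cat size_nseq.
by have -> : k < n - l by []; rewrite nth_nseq; case: ifP.
Qed.

Variable b : kompT a.
Let B := ext_komp b.

Lemma first_blackP i j : j <= n ->
  reflect (first_black B i j)
  [forall k : 'I_n,
     [&& i <= val k < j, val (b k).1 != 0 &
         [forall k' : 'I_n, (i <= val k' < val k) ==> (val (b k').1 == 0)]]
     ==> ~~ (b k).2].
Proof.
move=> jn; apply: (iffP forallP) => [h k /andP[h1 h2] h3 h4|h k].
  have kn : k < n by lia.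
  have := h (Ordinal kn); move: h3 h4.
  rewrite -[k]/(val (Ordinal kn)) /B ext_kompE /= h1 h2 => -> /= h4 /implyP; apply.
  apply/forallP => k'; apply/implyP => hk'.
  by have := h4 k' hk'; rewrite ext_kompE /= => ->.
apply/implyP => /and3P[h1 h2 /forallP h3].
have := h k h1; rewrite /B ext_kompE /=; apply => // k' hk'.
have k'n : k' < n by have := ltn_ord k; lia.
have := h3 (Ordinal k'n); rewrite /= hk' /= => /eqP e.
by rewrite -[k']/(val (Ordinal k'n)) ext_kompE.
Qed.

Lemma is_glideP : (forall k, (B k).2 -> 0 < (B k).1) ->
  is_glide b <-> glides B c n.
Proof.
move=> rp; rewrite /is_glide -/n.
have -> : [forall k : 'I_n, (b k).2 ==> (0 < val (b k).1)].
  by apply/forallP => k; apply/implyP => hk; have := rp k; rewrite /B ext_kompE; apply.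
rewrite /= glide_pos size_iota.
have nthp j : j < l -> nth 0 (iota (n - l) l) j = n - l + j by move=> h; rewrite nth_iota.
split.
  case/existsP => s /andP[/forallP h /forallP z].
  pose s' := [seq val i | i <- s].
  have ss' : size s' = l by rewrite size_map size_tuple.
  have sn t : nth 0 (0 :: s') t <= n.
    case: t => // t /=; case: (ltnP t l) => tl; last by rewrite nth_default // ss'.
    rewrite (nth_map ord0) ?size_tuple //; by rewrite -ltnS; apply: ltn_ord.
  exists (last 0 s'); split.
  - by rewrite (last_nth 0).
  - apply/blocksP; exists s'; split=> // t tl.
    have /and4P[h1 h2 h3 h4] := h (Ordinal tl); split=> //.
    move: h3 h4; rewrite /= nthp // nth_a_pos.
    rewrite sum_range ?(sn t.+1) // card_red_range ?(sn t.+1) // => /eqP h3.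
    by move/first_blackP => h4; split=> //; apply: h4; apply: (sn t.+1).
  - move=> k /andP[k1 k2]; have := z (Ordinal k2).
    rewrite -[k]/(val (Ordinal k2)) /B ext_kompE /=.
    have lE : nth 0 (0 :: s') l = last 0 s' by rewrite (last_nth 0) ss'.
    by move/implyP => hz; apply/eqP/hz; rewrite lE.
case=> j [jn /blocksP[s [ss ls hs]] z].
(* Block ends grow by at least one per block. As the nonzero places of [a] are its last [l] places,
   $i_\ell \le n$ then yields all the bounds $i_j \le n_j$. *)
have mono t d : t + d <= l -> nth 0 (0 :: s) t + d <= nth 0 (0 :: s) (t + d).
  elim: d => [|d IH] h; first by rewrite !addn0.
  have td : t + d < size c by move: h; rewrite /l; lia.
  rewrite !addnS; have [+ _] := hs _ td.
  by apply: leq_ltn_trans; apply: IH; lia.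
have lastE : nth 0 (0 :: s) l = j by rewrite -ls (last_nth 0) ss.
have sn t : t <= l -> nth 0 (0 :: s) t <= n.
  by move=> tl; have := mono t (l - t); rewrite subnKC // lastE => /(_ (leqnn _)); lia.
have szs : size [seq inord i : 'I_n.+1 | i <- s] == l by rewrite size_map ss.
apply/existsP; exists (Tuple szs); rewrite /=.
have es : [seq val i | i <- [seq inord i : 'I_n.+1 | i <- s]] = s.
  rewrite -map_comp -[RHS]map_id; apply/eq_in_map => i /(nthP 0)[t]; rewrite ss => tl <- /=.
  by rewrite inordK // ltnS; apply: (sn t.+1).
rewrite es; apply/andP; split; apply/forallP => t.
  have tl : t < l := ltn_ord t.
  have [h1 [h2 h3]] := hs t tl; apply/and4P; split=> //.
  - rewrite nthp //; have := mono t.+1 (l - t.+1); rewrite subnKC // lastE => /(_ (leqnn _)).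
    by rewrite /=; have := size_c_le; lia.
  - rewrite nthp // nth_a_pos sum_range ?(sn t.+1) // card_red_range ?(sn t.+1) //.
    by apply/eqP.
  - by apply/first_blackP => //; apply: (sn t.+1).
apply/implyP; rewrite lastE => hj; apply/eqP.
by have := z t; rewrite hj ltn_ord /B ext_kompE; apply.
Qed.
End IsGlide.

Section GlidePoly.
Local Open Scope ring_scope.
Variables (R : comPzRingType) (beta : R) (x : nat -> R).

Lemma komp_mon_prod bs : komp_mon beta x bs =
  \prod_(v < size bs) (beta ^+ (nth (0%N, false) bs v).2 *
     x (size bs - v)%N ^+ (nth (0%N, false) bs v).1).
Proof.
elim: bs => [|[b r] bs IH]; first by rewrite big_ord0.
rewrite big_ord_recl /= subn0; congr (_ * _).
by rewrite IH; apply: eq_bigr => v _; rewrite /bump /= add1n subSS.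
Qed.

Definition komp_of (a : seq nat) (t : (size a).-tuple ('I_(glide_bound a) * bool)) : kompT a :=
  [ffun k => tnth t (rev_ord k)].

Lemma glide_rec_red c bs : glide_rec c bs -> all (fun p => p.2 ==> (0 < p.1)%N) bs.
Proof.
elim: bs c => // -[b r] bs IH c /= /andP[_].
by case: r => [/andP[-> /IH]|/IH].
Qed.

Lemma ext_komp_of a t : [seq ext_komp (@komp_of a t) (size a - k.+1)%N | k <- iota 0 (size a)]
  = map (@kpair _) t.
Proof.
apply: (@eq_from_nth _ (0%N, false)); first by rewrite !size_map size_iota size_tuple.
move=> i; rewrite size_map size_iota => hi.
rewrite (nth_map 0%N) ?size_iota // nth_iota // add0n.
have := ext_kompE (komp_of t) (rev_ord (Ordinal hi)); rewrite /= => ->.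
have d : 'I_(glide_bound a) * bool := tnth t (Ordinal hi).
by rewrite ffunE rev_ordK (nth_map d) ?size_tuple // /kpair (tnth_nth d).
Qed.

Lemma glide_poly_komp_sum (a c : seq nat) : all (fun y => (0 < y)%N) c ->
  rev a = c ++ nseq (size a - size c) 0%N ->
  glide_poly a beta x = komp_sum beta x (glide_bound a) (size a) c.
Proof.
move=> c0 ra; rewrite /glide_poly.
rewrite (reindex (@komp_of a)) /=; last first.
  exists (fun b : kompT a => [tuple b (rev_ord k) | k < size a]) => [t _|b _].
    by apply: eq_from_tnth => k; rewrite tnth_mktuple ffunE rev_ordK.
  by apply/ffunP => k; rewrite ffunE tnth_mktuple rev_ordK.
apply: eq_big => [t|t _].
  apply/idP/idP => [h|h].
    have rp : forall k, (ext_komp (komp_of t) k).2 -> (0 < (ext_komp (komp_of t) k).1)%N.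
      case/andP: h => /forallP h _ k; rewrite /ext_komp; case: insubP => //= k' _ _.
      by move/(implyP (h k')).
    by rewrite -(ext_komp_of t); apply/(glides_rec rp) => //; apply/is_glideP.
  have rp : forall k, (ext_komp (komp_of t) k).2 -> (0 < (ext_komp (komp_of t) k).1)%N.
    move=> k; case: (ltnP k (size a)) => hk; last first.
      by rewrite /ext_komp insubF // ltnNge hk.
    have := glide_rec_red h; rewrite -(ext_komp_of t) => /allP/(_ (ext_komp (komp_of t) k)) h2 hr.
    apply: (implyP (h2 _)) => //; apply/mapP; exists (size a - k.+1)%N; first by rewrite mem_iota; lia.
    by congr ext_komp; lia.
  apply/(is_glideP c0 ra) => //; apply/(glides_rec rp) => //.
  by rewrite ext_komp_of.
rewrite komp_mon_prod !size_map size_tuple big_split /=; congr (_ * _).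
  rewrite prodrXr; congr (_ ^+ _).
  rewrite cardsE -sum1_card [LHS]big_mkcond (reindex_inj rev_ord_inj) /=.
  apply: eq_bigr => v _; rewrite unfold_in /= ffunE rev_ordK.
  by rewrite (nth_map (tnth t v)) ?size_tuple // -tnth_nth /=; case: (_.2).
rewrite [LHS](reindex_inj rev_ord_inj) /=; apply: eq_bigr => v _.
rewrite ffunE rev_ordK (nth_map (tnth t v)) ?size_tuple // -tnth_nth.
by congr (x _ ^+ _); have := ltn_ord v; lia.
Qed.
End GlidePoly.

(** * Tableaux as words *)

Section Timeline.
Variables (n N : nat) (ds : seq (seq nat)).

(* The letter [a] of row [v] is read at time [v * N + a]. *)
Definition used (t : nat) : bool := t %% N \in nth [::] ds (t %/ N).

Definition upto (k : nat) : seq nat := [seq t %% N | t <- iota 0 k & used t].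

(** Every pair of a row and a letter has its own instant, whether or not the letter occurs, so
    states before and after different letters are compared by arithmetic on times rather than on
    indices into the word. *)
Definition at_time (k : nat) : nat -> nat := run id (upto k).

Lemma uptoS k : upto k.+1 = upto k ++ (if used k then [:: k %% N] else [::]).
Proof.
rewrite /upto -{1}addn1 iotaD filter_cat map_cat /= add0n.
by case: (used k).
Qed.

Lemma at_timeS k i :
  at_time k.+1 i = if used k then hop (k %% N) (at_time k i) else at_time k i.
Proof. by rewrite /at_time uptoS run_cat; case: (used k). Qed.

Lemma at_time0 i : at_time 0 i = i. Proof. by []. Qed.

Lemma valid_uptoS k : valid n id (upto k.+1) =
  valid n id (upto k) &&
  (used k ==> (occ n (at_time k) (k %% N) != occ n (at_time k) (k %% N).+1)).
Proof. by rewrite uptoS valid_cat -/(at_time k); case: (used k); rewrite //= andbT. Qed.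

Lemma valid_upto_le k k' : k <= k' -> valid n id (upto k') -> valid n id (upto k).
Proof.
elim: k' => [|k' IH]; first by rewrite leqn0 => /eqP ->.
rewrite leq_eqVlt => /orP[/eqP -> //|h]; rewrite valid_uptoS => /andP[v _].
exact: IH.
Qed.

Lemma at_time_le k k' i : k <= k' -> at_time k i <= at_time k' i.
Proof.
elim: k' => [|k' IH]; first by rewrite leqn0 => /eqP ->.
rewrite leq_eqVlt => /orP[/eqP -> //|h]; apply: leq_trans (IH h) _.
by rewrite at_timeS; case: ifP => // _; rewrite /hop; case: eqP => // ->.
Qed.

Lemma upto_flatten : 0 < N -> size ds = n -> all (sorted ltn) ds ->
  all (fun x => x < N) (flatten ds) -> upto (n * N) = flatten ds.
Proof.
move=> N0 sd hs hf.
have row v : v < n -> [seq t %% N | t <- iota (v * N) N & used t] = nth [::] ds v.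
  move=> vn; have vs : v < size ds by rewrite sd.
  have hv : all (fun x => x < N) (nth [::] ds v).
    apply/allP => x hx; apply: (allP hf); apply/flattenP.
    by exists (nth [::] ds v) => //; apply: mem_nth.
  have e a : a < N -> (v * N + a) %% N = a by move=> aN; rewrite modnMDl modn_small.
  have e2 a : a < N -> (v * N + a) %/ N = v by move=> aN; rewrite divnMDl // divn_small // addn0.
  have -> : iota (v * N) N = [seq v * N + a | a <- iota 0 N] by rewrite -iotaDl addn0.
  rewrite filter_map -map_comp.
  have -> : [seq a <- iota 0 N | preim (addn (v * N)) used a] =
            [seq a <- iota 0 N | a \in nth [::] ds v].
    by apply: eq_in_filter => a; rewrite mem_iota => /andP[_ aN]; rewrite /= /used e // e2.
  rewrite (_ : map _ _ = [seq a <- iota 0 N | a \in nth [::] ds v]); last first.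
    rewrite -[RHS]map_id; apply/eq_in_map => a; rewrite mem_filter mem_iota.
    by case/andP => _ /andP[_ aN] /=; rewrite e.
  apply: (irr_sorted_eq ltn_trans ltnn).
  - by apply: sorted_filter; [exact: ltn_trans|exact: iota_ltn_sorted].
  - by apply: (allP hs); apply: mem_nth.
  by move=> x; rewrite mem_filter mem_iota /= add0n; case: (boolP (x \in _)) => // /(allP hv) ->.
have -> : flatten ds = flatten (take n ds) by rewrite -sd take_size.
have : n <= size ds by rewrite sd.
elim: n row => [|m IH] row hm; first by rewrite take0.
rewrite (take_nth [::]) // -cats1 flatten_cat /= cats0 -IH; last 2 first.
- by move=> v vm; apply: row; apply: ltnW.
- exact: ltnW.
by rewrite /upto mulSn addnC iotaD filter_cat map_cat add0n row.
Qed.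
End Timeline.

(** * From tableaux to particle motions *)

Section FromTableau.
Variables (n N : nat) (ds : seq (seq nat)) (L : nat -> nat).
(** [tp v i c] means that box [c] of the row of particle [i] contains [v]. Particle [i] owns tableau
    row [n - 1 - i], so a larger [i] is a higher row and entries decrease strictly in [i] along a
    column. *)
Variable tp : nat -> nat -> nat -> Prop.
Hypothesis tp_shape : forall v i c, tp v i c -> [/\ v < n, i < n & c < L i].
Hypothesis tp_full : forall i c, i < n -> c < L i -> exists v, tp v i c.
Hypothesis tp_row : forall v v' i c, tp v i c -> tp v' i c.+1 -> v <= v'.
Hypothesis tp_col : forall v v' i c, tp v i.+1 c -> tp v' i c -> v < v'.
Hypothesis L_mono : forall i, i.+1 < n -> L i <= L i.+1.
Hypothesis L_bound : forall i, i < n -> i + L i <= N.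
Hypothesis used_tp : forall t,
  used N ds t <-> exists i c, tp (t %/ N) i c /\ t %% N = i + c.

Lemma tp_row_lt v v' i c c' : tp v i c -> tp v' i c' -> c < c' -> v <= v'.
Proof.
move=> h; elim: c' v' => // c' IH v' h'; rewrite ltnS leq_eqVlt => /orP[/eqP e|lt].
  by apply: (@tp_row _ _ i c) => //; rewrite e.
have [v1 i1 c1] := tp_shape h'.
have [u hu] := tp_full i1 (ltnW c1).
exact: leq_trans (IH u hu lt) (tp_row hu h').
Qed.

Lemma tp_col_lt v v' i i' c : tp v i' c -> tp v' i c -> i < i' -> v < v'.
Proof.
move=> h' h; elim: i' v h' => // i' IH v h'; rewrite ltnS leq_eqVlt => /orP[/eqP e|lt].
  by apply: (@tp_col _ _ i c) => //; rewrite e.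
have [v1 i1 c1] := tp_shape h; have [v2 i2 c2] := tp_shape h'.
have c3 : c < L i'.
  have mono j : i + j < n -> L i <= L (i + j).
    elim: j => [|j IHj] hj; first by rewrite addn0.
    rewrite addnS in hj *; apply: leq_trans (IHj (ltnW hj)) (L_mono hj).
  by have := mono (i' - i); rewrite subnKC ?(ltnW lt) // => /(_ (ltnW i2)); lia.
have [u hu] := tp_full (ltnW i2) c3.
exact: ltn_trans (tp_col h' hu) (IH u hu lt).
Qed.

Lemma tp_time v i c : tp v i c -> v * N + (i + c) < n * N.
Proof.
move=> /tp_shape[vn i_n cL]; have := L_bound i_n => b.
have : v.+1 * N <= n * N by rewrite leq_mul2r vn orbT.
by rewrite mulSn; lia.
Qed.

Lemma time_eq t v a : t %/ N = v -> t %% N = a -> t = v * N + a.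
Proof. by move=> <- <-; apply: divn_eq. Qed.

Lemma time_tp v i c t : tp v i c -> t = v * N + (i + c) ->
  t %/ N = v /\ t %% N = i + c.
Proof.
move=> /tp_shape[vn i_n cL] ->; have := L_bound i_n => b.
by rewrite modnMDl modn_small ?divnMDl ?divn_small ?addn0 //; lia.
Qed.

(** Particle [i] crosses edge [c] as soon as the least entry of its box [c] is read. The positions
    at time [k] thus draw the diagram of the boxes that have an entry read before [k]. *)
Definition run_inv k := forall i, i < n -> i <= at_time N ds k i /\
  forall c, i + c < at_time N ds k i <->
    exists v, tp v i c /\ v * N + (i + c) < k.

(** Entries to the right of the box come later and some entry to its left came earlier, which
    confines particle [i0] to the two ends of the edge. Particles of lower rows have not crossed
    their edge [c0], those of higher rows have, so they avoid both ends. Hence exactly one end is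
    occupied and the letter is valid. *)
Lemma run_inv_used k i0 c0 : run_inv k -> used N ds k ->
  tp (k %/ N) i0 c0 -> k %% N = i0 + c0 ->
  (at_time N ds k i0 = i0 + c0 \/ at_time N ds k i0 = (i0 + c0).+1) /\
  forall i, i < n -> i != i0 ->
    at_time N ds k i != i0 + c0 /\ at_time N ds k i != (i0 + c0).+1.
Proof.
move=> inv us h0 ek; have [v0 i0n c0L] := tp_shape h0.
have kE := time_eq (erefl (k %/ N)) ek.
have N0 : 0 < N by have := L_bound i0n; lia.
have lt_time v v' a a' : v < v' -> a < N -> v * N + a < v' * N + a'.
  move=> lt aN; apply: (@leq_trans (v.+1 * N)); first by rewrite mulSn addnC ltn_add2r.
  by apply: leq_trans (leq_addr _ _); rewrite leq_mul2r lt orbT.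
have le_time v v' a a' : v <= v' -> a < a' -> v * N + a < v' * N + a'.
  by move=> le lt; rewrite -addnS leq_add // leq_mul2r le orbT.
split.
  have [ge hc] := inv i0 i0n.
  have up : ~ (i0 + c0.+1 < at_time N ds k i0).
    move/hc => [v [hv]]; rewrite ltnNge => /negP; apply.
    rewrite {1}kE; apply: ltnW; apply: le_time; last lia.
    exact: tp_row h0 hv.
  have low : i0 + c0 <= at_time N ds k i0.
    case: (posnP c0) => [->|c0p]; first by rewrite addn0.
    have [u hu] := tp_full i0n (leq_ltn_trans (leq_pred c0) c0L).
    have : i0 + c0.-1 < at_time N ds k i0.
      apply/hc; exists u; split=> //; rewrite [X in _ < X]kE.
      apply: le_time; last lia.
      by apply: (tp_row_lt hu h0); lia.
    by lia.
  by lia.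
move=> i i_n ni; have [ge hc] := inv i i_n.
case: (ltngtP i i0) ni => // lt _.
  have : ~ (i + c0 < at_time N ds k i).
    move/hc => [v [hv]]; rewrite ltnNge => /negP; apply.
    rewrite {1}kE; apply: ltnW; apply: lt_time.
      exact: tp_col_lt h0 hv lt.
    by have := L_bound i0n; lia.
  by lia.
have c0i : c0 < L i.
  have mono j : i0 + j < n -> L i0 <= L (i0 + j).
    elim: j => [|j IHj] hj; first by rewrite addn0.
    rewrite addnS in hj *; apply: leq_trans (IHj (ltnW hj)) (L_mono hj).
  by have := mono (i - i0); rewrite subnKC ?(ltnW lt) // => /(_ i_n); lia.
have [u hu] := tp_full i_n c0i.
have : i + c0 < at_time N ds k i.
  apply/hc; exists u; split=> //; rewrite [X in _ < X]kE.
  apply: lt_time; first exact: tp_col_lt hu h0 lt.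
  by have := L_bound i_n; lia.
by lia.
Qed.

Lemma run_inv_all k : run_inv k /\ valid n id (upto N ds k).
Proof.
elim: k => [|k [IH val]].
  split=> // i i_n; rewrite at_time0; split=> // c; split; first by lia.
  by case=> v [].
rewrite valid_uptoS val /=; case us: (used N ds k); last first.
  split=> // i i_n; rewrite at_timeS us; have [ge hc] := IH i i_n; split=> // c.
  split=> [/hc[v [hv lt]]|[v [hv]]]; first by exists v; split=> //; apply: ltnW.
  rewrite ltnS leq_eqVlt => /orP[/eqP e|lt]; last by apply/hc; exists v.
  have [e1 e2] := time_tp hv (esym e).
  suff : used N ds k by rewrite us.
  by apply/used_tp; exists i, c; rewrite e1 e2.
have [i0 [c0 [h0 ek]]] := (used_tp k).1 us.
have [v0 i0n c0L] := tp_shape h0.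
have [h1 h2] := run_inv_used IH us h0 ek.
split; last first.
  rewrite /= ek; case: h1 => h1.
    have -> : occ n (at_time N ds k) (i0 + c0) by apply/occP; exists i0.
    apply/eqP => /esym/occP[i i_n]; case: (eqVneq i i0) => [->|ne e]; first by lia.
    by have [_] := h2 i i_n ne; rewrite e eqxx.
  have -> : occ n (at_time N ds k) (i0 + c0).+1 by apply/occP; exists i0.
  apply/eqP => /occP[i i_n]; case: (eqVneq i i0) => [->|ne e]; first by lia.
  by have [+ _] := h2 i i_n ne; rewrite e eqxx.
have kE := time_eq (erefl (k %/ N)) ek.
move=> i i_n; rewrite at_timeS us ek; have [ge hc] := IH i i_n.
case: (eqVneq i i0) => [ei|ne].
  have -> : hop (i0 + c0) (at_time N ds k i) = (i0 + c0).+1.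
    by rewrite /hop ei; case: eqP; case: h1; lia.
  split; first by lia.
  move=> c; split=> [lt|[v [hv]]].
    have : c <= c0 by lia.
    rewrite leq_eqVlt => /orP[/eqP ->|cc].
      by exists (k %/ N); rewrite ei; split=> //; rewrite -kE.
    have : i + c < at_time N ds k i by rewrite ei; case: h1; lia.
    by move/hc => [v [hv lt']]; exists v; split=> //; apply: ltnW.
  rewrite ltnS leq_eqVlt => /orP[/eqP e|lt].
    have [e1 e2] := time_tp hv (esym e); lia.
  have : i + c < at_time N ds k i by apply/hc; exists v.
  by rewrite ei; case: h1; lia.
have [n1 n2] := h2 i i_n ne.
rewrite /hop (negbTE n1); split=> // c; split=> [/hc[v [hv lt]]|[v [hv]]].
  by exists v; split=> //; apply: ltnW.
rewrite ltnS leq_eqVlt => /orP[/eqP e|lt]; last by apply/hc; exists v.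
have [e1 e2] := time_tp hv (esym e).
(* Two boxes on one diagonal cannot share an entry: the box in the column of one and the row of the
   other would have an entry [u] that is both larger than it and at most equal to it. *)
exfalso; case: (ltngtP i i0) ne => // lt _.
  have cc : c0 < c by lia.
  have [_ _ cL] := tp_shape hv.
  have [u hu] := tp_full i_n (ltn_trans cc cL).
  have := tp_col_lt h0 hu lt; have := tp_row_lt hu hv cc; lia.
have cc : c < c0 by lia.
have [u hu] := tp_full i0n (ltn_trans cc c0L).
have := tp_col_lt hv hu lt; have := tp_row_lt hu h0 cc; lia.
Qed.

Lemma tableau_final i : i < n -> at_time N ds (n * N) i = i + L i.
Proof.
move=> i_n; have [inv _] := run_inv_all (n * N); have [ge hc] := inv i i_n.
have e c : i + c < at_time N ds (n * N) i <-> c < L i.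
  split=> [/hc[v [/tp_shape[] //]]|cL].
  by have [v hv] := tp_full i_n cL; apply/hc; exists v; split=> //; apply: tp_time.
apply/eqP; rewrite eqn_leq; apply/andP; split.
  rewrite leqNgt; apply/negP => h; have := (e (L i)).1 h; lia.
rewrite leqNgt; apply/negP => h.
have := (e (at_time N ds (n * N) i - i)).2; lia.
Qed.

(** Right after a letter, only the particle of its box stands just beyond it. The motion therefore
    tells which box an entry belongs to, and the word alone determines the tableau. *)
Lemma tp_recover v i c : tp v i c <->
  [/\ v < n, i < n, i + c < N, used N ds (v * N + (i + c)) &
      at_time N ds (v * N + (i + c)).+1 i = (i + c).+1].
Proof.
split=> [h|[vn i_n icN us e]].
  have [vn i_n cL] := tp_shape h; have b := L_bound i_n.
  have [e1 e2] := time_tp h erefl.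
  have us : used N ds (v * N + (i + c)).
    by apply/used_tp; exists i, c; rewrite e1 e2.
  split=> //; first by lia.
  rewrite at_timeS us e2; have [inv _] := run_inv_all (v * N + (i + c)).
  have h' : tp ((v * N + (i + c)) %/ N) i c by rewrite e1.
  have [h1 _] := run_inv_used inv us h' e2.
  by rewrite /hop; case: eqP; case: h1 => //; lia.
have [i0 [c0 [h0 ek]]] := (used_tp _).1 us.
have [inv _] := run_inv_all (v * N + (i + c)).
have [h1 h2] := run_inv_used inv us h0 ek.
have N0 : 0 < N by lia.
rewrite modnMDl modn_small // in ek.
rewrite divnMDl // divn_small // addn0 in h0.
case: (eqVneq i i0) => [ei|ne].
  have cc : c = c0 by lia.
  by rewrite cc ei.
have [n1 n2] := h2 i i_n ne.
rewrite -ek in n1 n2.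
by move: e; rewrite at_timeS us modnMDl modn_small // /hop (negbTE n1) => /eqP; rewrite (negbTE n2).
Qed.
End FromTableau.

(** * From particle motions to tableaux *)

Section FromWord.
Variables (n N : nat) (ds : seq (seq nat)) (L : nat -> nat).
Hypothesis val : valid n id (upto N ds (n * N)).
Hypothesis final : forall i, i < n -> at_time N ds (n * N) i = i + L i.
Hypothesis L_bound : forall i, i < n -> i + L i < N.
Hypothesis size_ds : size ds = n.

(* Box [c] of the row of particle [i] contains [v] when the letter [i + c] of
   row [v] moves particle [i] across the edge [c], or finds it just beyond. *)
Definition touched v i c : Prop :=
  [/\ v < n, i < n, i + c < N, used N ds (v * N + (i + c)) &
      at_time N ds (v * N + (i + c)).+1 i = (i + c).+1].

Lemma used_lt t : used N ds t -> t < n * N.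
Proof.
rewrite /used ltnNge => h; apply/negP => le.
case: (posnP N) => [N0|N0].
  case: (posnP n) => [n0|n0]; last by have := L_bound n0; rewrite N0.
  by move: h; rewrite nth_default // size_ds n0.
by move: h; rewrite nth_default // size_ds leq_divRL.
Qed.

Lemma incp_at_time k : k <= n * N -> incp n (at_time N ds k).
Proof.
by move=> h; apply: incp_run; [move=> i _ /=|apply: valid_upto_le h val].
Qed.

Lemma step_occ t : used N ds t ->
  ~~ occ n (at_time N ds t.+1) (t %% N) && occ n (at_time N ds t.+1) (t %% N).+1.
Proof.
move=> us; have := valid_upto_le (used_lt us) val.
rewrite valid_uptoS us => /andP[_ /= /occ_hop].
rewrite (@occ_ext _ (at_time N ds t.+1) (fun i => hop (t %% N) (at_time N ds t i))).
  by rewrite (@occ_ext _ (at_time N ds t.+1) (fun i => hop (t %% N) (at_time N ds t i))) // => i;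
     rewrite at_timeS us.
by move=> i; rewrite at_timeS us.
Qed.

Lemma touched_shape v i c : touched v i c -> [/\ v < n, i < n & c < L i].
Proof.
case=> vn i_n icN us e; split=> //.
have := at_time_le N ds i (used_lt us); rewrite e final //; lia.
Qed.

Lemma touched_full i c : i < n -> c < L i -> exists v, touched v i c.
Proof.
move=> i_n cL; pose P k := i + c < at_time N ds k i.
have ex : exists k, P k by exists (n * N); rewrite /P final //; lia.
(* The least time at which the particle is beyond the edge follows immediately the letter that
   carried it across. *)
case: (ex_minnP ex) => -[|t] Pt mint; first by move: Pt; rewrite /P at_time0; lia.
have tle : at_time N ds t i <= i + c.
  by rewrite leqNgt; apply/negP => /mint; rewrite ltnn.
move: Pt; rewrite /P at_timeS; case us: (used N ds t) => Pt; last by lia.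
have e : t %% N = i + c /\ at_time N ds t i = i + c.
  by move: Pt; rewrite /hop; case: eqP => [<-|]; lia.
case: e => e1 e2; have tE := divn_eq t N; rewrite e1 in tE.
have tn := used_lt us; have b := L_bound i_n.
exists (t %/ N); rewrite /touched -tE us at_timeS us e1 e2 /hop eqxx; split=> //; last by lia.
by rewrite ltn_divLR //; lia.
Qed.

Lemma touched_row v v' i c : touched v i c -> touched v' i c.+1 -> v <= v'.
Proof.
move=> [_ _ h1 us e] [_ _ h2 us' e']; rewrite leqNgt; apply/negP => lt.
have le : v'.+1 * N <= v * N by rewrite leq_mul2r lt orbT.
have := @at_time_le N ds (v' * N + (i + c.+1)).+1 (v * N + (i + c)).+1 i.
rewrite e e'; move: le; rewrite mulSn; lia.
Qed.

(** Otherwise particle [i], already at [i + c + 1] or further and kept behind particle [i.+1], would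
    stand at the letter just read, which a letter leaves empty. *)
Lemma touched_col v v' i c : touched v i.+1 c -> touched v' i c -> v < v'.
Proof.
move=> [_ i1 h1 us e] [_ i2 h2 us' e']; rewrite ltnNge; apply/negP => le0.
have le : v' * N <= v * N by rewrite leq_mul2r le0 orbT.
have tt : (v' * N + (i + c)).+1 <= (v * N + (i.+1 + c)).+1 by lia.
have m := at_time_le N ds i tt; rewrite e' in m.
have inc := incp_at_time (used_lt us) i1; rewrite e in inc.
have /andP[/occP no _] := step_occ us; apply: no; exists i => //.
by rewrite modnMDl modn_small //; lia.
Qed.

Lemma touched_used t : used N ds t <->
  exists i c, touched (t %/ N) i c /\ t %% N = i + c.
Proof.
split=> [us|[i [c [[_ _ _ us _] e]]]]; last by rewrite (divn_eq t N) e.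
have tn := used_lt us; have /andP[no /occP[i i_n e]] := step_occ us.
have N0 : 0 < N by case: (posnP N) tn => // ->; rewrite muln0.
(* If it failed, particle [i] would still be at its origin, and its left neighbour could only stand
   at the letter itself, which is empty. *)
have ge : i <= t %% N.
  rewrite leqNgt; apply/negP => lt.
  have ge := run_ge id (upto N ds t.+1) i; rewrite -/(at_time N ds t.+1 i) e in ge.
  have e1 : i = (t %% N).+1 by lia.
  have i1 : i.-1.+1 < n by lia.
  have := incp_at_time tn i1; have := run_ge id (upto N ds t.+1) i.-1.
  rewrite prednK; last by lia.
  rewrite -/(at_time N ds t.+1 i.-1) e => g1 g2; case/negP: no; apply/occP.
  by exists i.-1; lia.
exists i, (t %% N - i); rewrite /touched subnKC // -divn_eq e; split=> //; split=> //.
  by rewrite ltn_divLR.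
by rewrite ltn_pmod.
Qed.
End FromWord.

Lemma partition_nthS lam r : is_partition lam -> nth 0 lam r.+1 <= nth 0 lam r.
Proof.
move=> /andP[srt _].
case: (ltnP r.+1 (size lam)) => h; last by rewrite (nth_default _ h).
exact: (sortedP 0 srt).
Qed.

Lemma partition_head lam r : is_partition lam -> nth 0 lam r <= head 0 lam.
Proof.
move=> hl; rewrite -nth0; elim: r => // r; apply: leq_trans.
exact: partition_nthS.
Qed.

(** * The bijection between set-valued tableaux and words *)

Section Tab.
Variables (n : nat) (lam : seq nat).
Local Notation m := (head 0 lam).
Hypothesis lam_part : is_partition lam.
Hypothesis n_gt0 : 0 < n.

Definition tin (T : tabT n lam) (v r c : nat) : Prop :=
  exists (v' r' : 'I_n) (c' : 'I_m),
    [/\ val v' = v, val r' = r, val c' = c & v' \in T (r', c')].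

Lemma tgetP T (v : 'I_n) r c : v \in tget T r c <-> tin T v r c.
Proof.
rewrite /tget; split.
  case: insubP => [r' _ er|]; last by rewrite in_set0.
  case: insubP => [c' _ ec|]; last by rewrite in_set0.
  by exists v, r', c'.
move=> [v' [r' [c' [/val_inj -> <- <- h]]]].
by rewrite !valK.
Qed.

Lemma tinE T (v r : 'I_n) (c : 'I_m) : tin T v r c <-> v \in T (r, c).
Proof.
split=> [[v' [r' [c' [/val_inj -> /val_inj -> /val_inj -> //]]]]|h].
by exists v, r, c.
Qed.

Definition svt_spec (T : tabT n lam) : Prop :=
  [/\ forall v r c, tin T v r c -> c < nth 0 lam r,
      forall r c, r < n -> c < nth 0 lam r -> exists v, tin T v r c,
      forall v v' r c, tin T v r c -> tin T v' r c.+1 -> v <= v' &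
      forall v v' r c, tin T v r c -> tin T v' r.+1 c -> v < v'].

Lemma is_svtP T : is_svt T <-> svt_spec T.
Proof.
split.
  case/andP => /andP[/forallP h1 /forallP h2] /forallP h3.
  have s1 v r c : tin T v r c -> c < nth 0 lam r.
    case=> v' [r' [c' [_ <- <- h]]]; have := h1 (r', c').
    by rewrite /inshape /= => /eqP ->; apply/set0Pn; exists v'.
  split=> //.
  - move=> r c rn cl; have cm : c < m := leq_trans cl (partition_head _ lam_part).
    have := h1 (Ordinal rn, Ordinal cm); rewrite /inshape /= cl => /eqP/esym/set0Pn[v hv].
    by exists v, v, (Ordinal rn), (Ordinal cm).
  - move=> v v' r c t1 t2; have [v1 [r1 [c1 [e1 e2 e3 _]]]] := t1.
    have [v2 [r2 [c2 [e4 _ _ _]]]] := t2.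
    have /forallP/(_ c1)/implyP := h2 r1.
    rewrite /inshape e2 e3 (s1 _ _ _ t2) => /(_ isT) /forall_inP h.
    rewrite -e1 -e4 in t1 t2 *; move/tgetP: t1 => /h /forall_inP; apply.
    exact/tgetP.
  - move=> v v' r c t1 t2; have [v1 [r1 [c1 [e1 e2 e3 _]]]] := t1.
    have [v2 [r2 [c2 [e4 _ _ _]]]] := t2.
    have /forallP/(_ c1)/implyP := h3 r1.
    rewrite /inshape e2 e3 (s1 _ _ _ t2) => /(_ isT) /forall_inP h.
    rewrite -e1 -e4 in t1 t2 *; move/tgetP: t1 => /h /forall_inP; apply.
    exact/tgetP.
move=> [s1 s2 s3 s4]; apply/andP; split; [apply/andP; split|].
- apply/forallP => -[r c]; rewrite /inshape /=; apply/eqP; apply/idP/set0Pn => [h|[v hv]].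
    have [v [v' [r' [c' [_ /val_inj <- /val_inj <- hv]]]]] := s2 r c (ltn_ord r) h.
    by exists v'.
  by apply: (s1 v); apply/tinE.
- apply/forallP => r; apply/forallP => c; apply/implyP => _.
  apply/forall_inP => a /tgetP ha; apply/forall_inP => b /tgetP hb.
  exact: s3 ha hb.
- apply/forallP => r; apply/forallP => c; apply/implyP => _.
  apply/forall_inP => a /tgetP ha; apply/forall_inP => b /tgetP hb.
  exact: s4 ha hb.
Qed.

Variable N : nat.
Hypothesis nN : n + m <= N.

Definition content (b : 'I_n * 'I_m) : nat := n - b.1.+1 + b.2.

Lemma content_lt b : content b < N.
Proof. by rewrite /content; have := ltn_ord b.1; have := ltn_ord b.2; lia. Qed.

Definition word_of_tab (T : tabT n lam) : n.-tuple {set 'I_N} :=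
  [tuple [set a : 'I_N | [exists b, (v \in T b) && (content b == a)]] | v < n].

(** The criterion of [tp_recover], turned into a definition. For the particle [n - 1 - r] it is the
    condition [touched]. *)
Definition tab_of_word (D : seq {set 'I_N}) : tabT n lam :=
  [ffun b => [set v : 'I_n |
     used N (rows D) (v * N + content b) &&
     (at_time N (rows D) (v * N + content b).+1 (n - b.1.+1) == (content b).+1)]].

Definition tpart (T : tabT n lam) v i c : Prop := i < n /\ tin T v (n - i.+1) c.

Definition Lpart i := nth 0 lam (n - i.+1).

Lemma Lpart_bound i : i < n -> i + Lpart i < N.
Proof. by move=> h; have := partition_head (n - i.+1) lam_part; rewrite /Lpart; lia. Qed.

Lemma Lpart_mono i : i.+1 < n -> Lpart i <= Lpart i.+1.
Proof.
move=> h; rewrite /Lpart; have -> : n - i.+1 = (n - i.+2).+1 by lia.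
exact: partition_nthS.
Qed.

Lemma nth_rows (D : n.-tuple {set 'I_N}) (v : 'I_n) :
  nth [::] (rows D) v = srow (tnth D v).
Proof. by rewrite (nth_map set0) ?size_tuple // (tnth_nth set0). Qed.

Lemma nth_rows_default (D : n.-tuple {set 'I_N}) v : n <= v -> nth [::] (rows D) v = [::].
Proof. by move=> h; rewrite nth_default // size_map size_tuple. Qed.

Lemma mem_word_of_tab T v a : a \in nth [::] (rows (word_of_tab T)) v <->
  exists i c, tpart T v i c /\ a = i + c.
Proof.
split=> [h|[i [c [[i_n [v' [r' [c' [<- er <- hv]]]]] ->]]]].
  case: (ltnP v n) => vn; last by rewrite nth_rows_default in h.
  move: h; rewrite -[v]/(val (Ordinal vn)) nth_rows tnth_mktuple => /mapP[a'].
  rewrite mem_enum inE => /existsP[[r c] /andP[hT /eqP ec]] ->.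
  exists (n - r.+1), c; rewrite /tpart; have rn := ltn_ord r; split; last by rewrite -[LHS]ec.
  split; first by lia.
  have -> : n - (n - r.+1).+1 = r by lia.
  by apply/tinE.
have rn := ltn_ord r'.
have e : i + c' = content (r', c') by rewrite /content /= -[nat_of_ord r']/(val r') er; lia.
rewrite nth_rows tnth_mktuple e.
apply/mapP; exists (Ordinal (content_lt (r', c'))) => //.
by rewrite mem_enum inE; apply/existsP; exists (r', c'); rewrite hv /=.
Qed.

Section Forward.
Variable T : tabT n lam.
Hypothesis svtT : is_svt T.
Let ds := rows (word_of_tab T).

Lemma svt_part_shape v i c : tpart T v i c -> [/\ v < n, i < n & c < Lpart i].
Proof.
move=> [i_n h]; have [s1 _ _ _] := (is_svtP T).1 svtT; split=> //; last exact: s1 h.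
by case: h => v' [? [? [<- _ _ _]]]; exact: ltn_ord.
Qed.

Lemma svt_part_full i c : i < n -> c < Lpart i -> exists v, tpart T v i c.
Proof.
move=> i_n h; have [_ s2 _ _] := (is_svtP T).1 svtT.
by have [|v hv] := s2 (n - i.+1) c _ h; [lia|exists v].
Qed.

Lemma svt_part_row v v' i c : tpart T v i c -> tpart T v' i c.+1 -> v <= v'.
Proof. by move=> [_ h] [_ h']; have [_ _ s _] := (is_svtP T).1 svtT; apply: s h h'. Qed.

Lemma svt_part_col v v' i c : tpart T v i.+1 c -> tpart T v' i c -> v < v'.
Proof.
move=> [i1 h] [_ h']; have [_ _ _ s] := (is_svtP T).1 svtT; apply: s h _.
by have -> : (n - i.+2).+1 = n - i.+1 by lia.
Qed.

Lemma svt_part_used t : used N ds t <-> exists i c, tpart T (t %/ N) i c /\ t %% N = i + c.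
Proof. exact: mem_word_of_tab. Qed.

Lemma Lpart_boundW i : i < n -> i + Lpart i <= N.
Proof. by move/Lpart_bound/ltnW. Qed.

Lemma svt_part_upto : upto N ds (n * N) = flatten ds.
Proof.
apply: upto_flatten.
- by lia.
- by rewrite size_map size_tuple.
- exact: rows_sorted.
- exact: flatten_rows_lt.
Qed.

Lemma svt_word_of : word_of n lam (flatten ds).
Proof.
have [_ val] := run_inv_all svt_part_shape svt_part_full svt_part_row svt_part_col Lpart_mono Lpart_boundW svt_part_used (n * N).
rewrite svt_part_upto in val; rewrite /word_of val; apply/allP => i.
rewrite mem_iota add0n => /= i_n.
have := tableau_final svt_part_shape svt_part_full svt_part_row svt_part_col Lpart_mono Lpart_boundW svt_part_used i_n.
by rewrite /at_time svt_part_upto => ->; rewrite addnC.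
Qed.

Lemma word_of_tabK : tab_of_word (word_of_tab T) = T.
Proof.
apply/ffunP => -[r c]; apply/setP => v; rewrite ffunE inE.
have rn := ltn_ord r; have vn := ltn_ord v.
have e : n - (n - r.+1).+1 = r by lia.
have := tp_recover svt_part_shape svt_part_full svt_part_row svt_part_col Lpart_mono Lpart_boundW svt_part_used v (n - r.+1) c.
rewrite /tpart e tinE -/(content (r, c)) => h.
apply/andP/idP => [[us /eqP ea]|hv].
  by apply: (h.2 _).2; split=> //; [lia|exact: content_lt].
have [|_ _ _ us ea] := h.1 _; first by split=> //; lia.
by split=> //; apply/eqP.
Qed.
End Forward.

Section Backward.
Variable D : n.-tuple {set 'I_N}.
Hypothesis wD : word_of n lam (flatten (rows D)).
Let ds := rows D.

Lemma size_rows_tuple : size ds = n.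
Proof. by rewrite size_map size_tuple. Qed.

Lemma word_upto : upto N ds (n * N) = flatten ds.
Proof.
apply: upto_flatten.
- by lia.
- exact: size_rows_tuple.
- exact: rows_sorted.
- exact: flatten_rows_lt.
Qed.

Lemma word_valid : valid n id (upto N ds (n * N)).
Proof. by rewrite word_upto; case/andP: wD. Qed.

Lemma word_final i : i < n -> at_time N ds (n * N) i = i + Lpart i.
Proof.
move=> i_n; rewrite /at_time word_upto; case/andP: wD => _ /allP/(_ i).
by rewrite mem_iota add0n i_n => /(_ isT) /eqP ->; rewrite addnC.
Qed.

Lemma tin_tab_of_word v r c : r < n -> tin (tab_of_word D) v r c <->
  touched n N ds v (n - r.+1) c.
Proof.
move=> rn; split=> [[v' [r' [c' [<- er <- ]]]]|h].
  rewrite ffunE inE /content /= er => /andP[us /eqP ea].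
  have := content_lt (r', c'); rewrite /content /= er => lt.
  by split=> //; lia.
have [vn i_n cL] := touched_shape word_valid word_final Lpart_bound size_rows_tuple h.
have cm : c < m := leq_trans cL (partition_head _ lam_part).
case: h => _ _ _ us ea; exists (Ordinal vn), (Ordinal rn), (Ordinal cm); split=> //.
by rewrite ffunE inE /content /= us ea eqxx.
Qed.

Lemma tab_of_word_svt : is_svt (tab_of_word D).
Proof.
apply/is_svtP.
have rlt T v r c : @tin T v r c -> r < n by case=> ? [? [? [_ <- _ _]]]; exact: ltn_ord.
have L_eq r : r < n -> Lpart (n - r.+1) = nth 0 lam r.
  by move=> rn; rewrite /Lpart; congr nth; lia.
split.
- move=> v r c h; have rn := rlt _ _ _ _ h; move/(tin_tab_of_word v c rn): h.
  by move/(touched_shape word_valid word_final Lpart_bound size_rows_tuple) => [_ _]; rewrite L_eq.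
- move=> r c rn cl; have i_n : n - r.+1 < n by lia.
  have cL : c < Lpart (n - r.+1) by rewrite L_eq.
  have [v hv] := touched_full word_valid word_final Lpart_bound size_rows_tuple i_n cL.
  by exists v; apply/tin_tab_of_word.
- move=> v v' r c h h'; have rn := rlt _ _ _ _ h.
  move/(tin_tab_of_word _ _ rn): h; move/(tin_tab_of_word _ _ rn): h'.
  by move=> h' h; exact: (touched_row word_valid size_rows_tuple h h').
- move=> v v' r c h h'; have rn := rlt _ _ _ _ h; have rn' := rlt _ _ _ _ h'.
  move/(tin_tab_of_word _ _ rn): h; move/(tin_tab_of_word _ _ rn'): h'.
  have -> : n - r.+1 = (n - r.+2).+1 by lia.
  move=> h' h; exact: (touched_col word_valid Lpart_bound size_rows_tuple h h').
Qed.

Lemma tab_of_wordK : word_of_tab (tab_of_word D) = D.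
Proof.
apply: rows_inj; apply: (@eq_from_nth _ [::]).
  by rewrite [LHS]size_map [RHS]size_map !size_tuple.
move=> v; rewrite size_map size_tuple => vn.
apply: (irr_sorted_eq ltn_trans ltnn).
- by rewrite -[v]/(val (Ordinal vn)) nth_rows srow_sorted.
- by rewrite -[v]/(val (Ordinal vn)) nth_rows srow_sorted.
move=> a.
have tt i c : tpart (tab_of_word D) v i c <-> touched n N ds v i c.
  split=> [[i_n]|h].
    rewrite tin_tab_of_word; last by lia.
    by have -> : n - (n - i.+1).+1 = i by lia.
  have i_n : i < n by case: h.
  split=> //; rewrite tin_tab_of_word; last by lia.
  by have -> : n - (n - i.+1).+1 = i by lia.
have tu := touched_used word_valid Lpart_bound size_rows_tuple.
apply/idP/idP => [/mem_word_of_tab[i [c [/tt h ->]]]|h].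
  case: h => _ _ lt; rewrite /used modnMDl modn_small // divnMDl ?divn_small ?addn0 //; lia.
have aN : a < N.
  by move: h; rewrite -[v]/(val (Ordinal vn)) nth_rows => /srow_lt.
have us : used N ds (v * N + a).
  by rewrite /used modnMDl modn_small // divnMDl ?divn_small ?addn0 //; lia.
have [i [c [ht ec]]] := (tu _).1 us.
apply/mem_word_of_tab; exists i, c; move: ht ec.
rewrite modnMDl modn_small // divnMDl ?divn_small ?addn0 //; last by lia.
by move=> /tt.
Qed.
End Backward.
End Tab.

(** * The quasi-Yamanouchi condition and the weight on words *)

Lemma qy_rowsP qs : all (sorted ltn) qs -> qy_rows qs <->
  forall v a, a \in nth [::] qs v.+1 ->
    exists a1 a0, [/\ a1 \in nth [::] qs v.+1, a0 \in nth [::] qs v & a1 < a0].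
Proof.
elim: qs => [_|q qs IH]; first by split=> // _ v a; rewrite nth_nil.
rewrite [all _ _]/= => /andP[sq sqs]; have {}IH := IH sqs.
have key : is_true (match qs with [::] => true
  | q' :: _ => (q' != [::]) ==> (q != [::]) && (head 0 q' < last 0 q) end) <->
  (forall a, a \in nth [::] qs 0 ->
    exists a1 a0, [/\ a1 \in nth [::] qs 0, a0 \in q & a1 < a0]).
  case: qs sqs {IH} => [|q' qs] //= /andP[sq' _].
  case: q' sq' => [|x q'] sq' //=.
  case/lastP: q sq => [|q y] sq.
    split=> // /(_ x); rewrite inE eqxx => /(_ isT)[a1 [a0 []]].
    by rewrite in_nil.
  rewrite last_rcons; have -> : rcons q y != [::] by case: (q).
  split=> [lt a _|].
    by exists x, y; rewrite inE eqxx mem_rcons inE eqxx.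
  move=> /(_ x); rewrite inE eqxx => /(_ isT)[a1 [a0 [h1 h0 lt]]].
  have le1 : x <= a1.
    move: h1; rewrite inE => /orP[/eqP ->//|h1].
    by have /allP/(_ _ h1)/ltnW := order_path_min ltn_trans sq'.
  have le0 : a0 <= y.
    move: h0; rewrite mem_rcons inE => /orP[/eqP ->//|h0].
    move: sq; rewrite (sorted_pairwise ltn_trans) pairwise_rcons => /andP[/allP h _].
    exact: ltnW (h _ h0).
  by move: lt => /=; lia.
rewrite [qy_rows _]/=; split.
  by move=> /andP[h1 h2] [|v]; [exact: key.1 h1|exact: (IH.1 h2)].
move=> h; apply/andP; split; first by apply: key.2; exact: (h 0).
by apply: IH.2 => v; exact: (h v.+1).
Qed.

Section Weights.
Variables (n : nat) (lam : seq nat) (N : nat).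
Local Notation m := (head 0 lam).
Hypotheses (lam_part : is_partition lam) (n_gt0 : 0 < n) (nN : n + m <= N).
Variable T : tabT n lam.
Hypothesis svtT : is_svt T.
Local Notation ds := (rows (word_of_tab N T)).

Lemma partition_nth_le r r' : r <= r' -> nth 0 lam r' <= nth 0 lam r.
Proof.
move=> h; rewrite -(subnKC h); elim: (r' - r) => [|d IH]; first by rewrite addn0.
by apply: leq_trans IH; rewrite addnS; apply: partition_nthS.
Qed.

Lemma tpart_row v v' i c c' : tpart T v i c -> tpart T v' i c' -> c < c' -> v <= v'.
Proof.
exact: (tp_row_lt (svt_part_shape lam_part svtT) (svt_part_full lam_part n_gt0 nN svtT)
          (svt_part_row lam_part svtT)).
Qed.

Lemma tpart_col v v' i i' c : tpart T v i' c -> tpart T v' i c -> i < i' -> v < v'.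
Proof.
exact: (tp_col_lt (svt_part_shape lam_part svtT) (svt_part_full lam_part n_gt0 nN svtT)
  (svt_part_col lam_part n_gt0 nN svtT) (Lpart_mono lam_part n_gt0 nN)).
Qed.

Lemma tpart_full v i i' c c' : tpart T v i c -> i <= i' -> i' < n -> c' <= c ->
  exists u, tpart T u i' c'.
Proof.
move=> h ii i'n cc; have [_ i_n cL] := svt_part_shape lam_part svtT h.
apply: (svt_part_full lam_part n_gt0 nN svtT i'n).
have le : Lpart n lam i <= Lpart n lam i' by apply: partition_nth_le; lia.
lia.
Qed.

(** The corner box between two such boxes would need an entry at least [v] by its row and below [v]
    by its column. So a row of the word, although only a set of contents, counts boxes correctly. *)
Lemma tpart_diag v i i' c c' : tpart T v i c -> tpart T v i' c' ->
  i + c = i' + c' -> i = i'.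
Proof.
wlog lt : i i' c c' / i < i' => [hw h h' e|h h' e].
  case: (ltngtP i i') => // lt; first exact: hw lt h h' e.
  by apply/esym; apply: hw lt h' h (esym e).
have [_ i'n _] := svt_part_shape lam_part svtT h'.
have [u hu] := tpart_full h (ltnW lt) i'n (leqnn c).
have cc : c' < c by lia.
by have := tpart_row h' hu cc; have := tpart_col hu h lt; lia.
Qed.

(** Weakly left becomes smaller content. If [v.+1] were weakly left with no smaller content, it
    would lie in a higher row than [v], and the box above [v] in that row would contradict the
    inequalities. If it had smaller content but lay strictly to the right, [v] would be at least two
    rows higher, leaving room for two strict increases between [v] and [v.+1]. *)
Lemma qy_descent v i1 c1 i2 c2 : tpart T v.+1 i1 c1 -> tpart T v i2 c2 ->
  ((i1, c1) != (i2, c2)) && (c1 <= c2) = (i1 + c1 < i2 + c2).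
Proof.
move=> h1 h2; have [_ i1n _] := svt_part_shape lam_part svtT h1.
have [_ i2n c2L] := svt_part_shape lam_part svtT h2.
apply/andP/idP => [[ne le]|lt].
  rewrite ltnNge; apply/negP => ge.
  have ii : i2 < i1.
    rewrite ltn_neqAle; apply/andP; split; last by lia.
    by apply/eqP => e; case/eqP: ne; rewrite e; congr pair; lia.
  have [u hu] := tpart_full h2 (ltnW ii) i1n (leqnn c2).
  have uv := tpart_col hu h2 ii.
  move: le; rewrite leq_eqVlt => /orP[/eqP e|le].
    by rewrite e in h1; have := tpart_col h1 h2 ii; lia.
  by have := tpart_row h1 hu le; lia.
split; first by apply/eqP => -[e1 e2]; lia.
rewrite leqNgt; apply/negP => cc.
have ii : i1.+1 < i2 by lia.
have [u hu] := tpart_full h1 (leqnSn i1) (ltn_trans ii i2n) (ltnW cc).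
have [u' hu'] := tpart_full h1 (leqnn i1) i1n (ltnW cc).
have := tpart_col h2 hu ii; have := tpart_col hu hu' (ltnSn _).
by have := tpart_row hu' h1 cc; lia.
Qed.

Lemma tpart_ord (v : 'I_n) (b : 'I_n * 'I_m) :
  v \in T b <-> tpart T v (n - b.1.+1) b.2.
Proof.
case: b => r c; rewrite /tpart /=; have rn := ltn_ord r.
have -> : n - (n - r.+1).+1 = r by lia.
by rewrite tinE; split=> [h|[_ //]]; split=> //; lia.
Qed.

Lemma mem_svt_rows (v : nat) a : a \in nth [::] ds v <->
  exists i c, tpart T v i c /\ a = i + c.
Proof. exact: (mem_word_of_tab lam_part n_gt0 nN). Qed.

Lemma tpart_box v i c : tpart T v i c ->
  exists (v' : 'I_n) (b : 'I_n * 'I_m),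
    [/\ val v' = v, i = n - b.1.+1, c = b.2 & v' \in T b].
Proof.
move=> [i_n [v' [r [c' [ev er ec h]]]]]; exists v', (r, c'); split=> //=.
by rewrite /= in er; lia.
Qed.

Lemma is_qyE : is_qy T = qy_rows ds.
Proof.
have qP := qy_rowsP (rows_sorted (word_of_tab N T)).
apply/forallP/idP => [h|/qP.1 h v].
  apply: qP.2 => v a /mem_svt_rows[i [c [/tpart_box[v' [b [ev _ _ hb]]] _]]].
  have hv : (0 < val v') && [exists b0, v' \in T b0] by rewrite ev; apply/existsP; exists b.
  have /existsP[b1 /existsP[b2 /existsP[u /and5P[/eqP eu ne h1 h2 cc]]]] := implyP (h v') hv.
  have t1 := (tpart_ord v' b1).1 h1; have t2 := (tpart_ord u b2).1 h2.
  have euv : val u = v by move: eu; rewrite ev => -[].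
  rewrite ev in t1; rewrite euv in t2.
  exists (n - b1.1.+1 + b1.2), (n - b2.1.+1 + b2.2); split.
  - by apply/mem_svt_rows; eexists _, _; split; [exact: t1|].
  - by apply/mem_svt_rows; eexists _, _; split; [exact: t2|].
  rewrite -(qy_descent t1 t2) cc andbT; apply/eqP => -[e1 e2]; case/eqP: ne.
  case: b1 b2 {h1 h2 t1 t2 cc} e1 e2 => r1 c1 [r2 c2] /= e1 e2.
  have := ltn_ord r1; have := ltn_ord r2 => l1 l2.
  by congr pair; apply: val_inj => //=; lia.
apply/implyP => /andP[v0 /existsP[b hb]].
have t := (tpart_ord v b).1 hb.
have := h v.-1 (n - b.1.+1 + b.2); rewrite prednK // => /(_ _)[|a1 [a0 [h1 h0 lt]]].
  by apply/mem_svt_rows; eexists _, _; split; [exact: t|].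
move/mem_svt_rows: h1 => [i1 [c1 [t1 e1]]]; move/mem_svt_rows: h0 => [i0 [c0 [t0 e0]]].
rewrite e1 e0 in lt.
have := @qy_descent v.-1 i1 c1 i0 c0; rewrite prednK // => /(_ t1 t0).
rewrite lt => /andP[ne cc].
have [v1 [b1 [ev1 ei1 ec1 hb1]]] := tpart_box t1.
have [v2 [b2 [ev2 ei2 ec2 hb2]]] := tpart_box t0.
have e : v1 = v by apply: val_inj.
rewrite e in hb1.
apply/existsP; exists b1; apply/existsP; exists b2; apply/existsP; exists v2.
rewrite hb1 hb2 -[X in X <= _]ec1 -[X in _ <= X]ec2 cc andbT /=.
apply/andP; split; first by rewrite -[nat_of_ord v2]/(val v2) ev2 prednK.
by rewrite andbT; apply/eqP => eb; case/eqP: ne; rewrite ei1 ei2 ec1 ec2 eb.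
Qed.

Lemma tab_wtE : tab_wt T = [seq size d | d <- ds].
Proof.
apply: (@eq_from_nth _ 0).
  by rewrite [LHS]size_map size_enum_ord size_map [RHS]size_map size_tuple.
move=> v; rewrite [size _]size_map size_enum_ord => vn.
rewrite (nth_map (Ordinal vn)) ?size_enum_ord // (nth_map [::]); last first.
  by rewrite size_map size_tuple.
have -> : nth (Ordinal vn) (enum 'I_n) v = Ordinal vn.
  by apply: val_inj; rewrite /= nth_enum_ord.
rewrite cardE -(size_map (@content n lam)); apply: perm_size; apply: uniq_perm.
- rewrite map_inj_in_uniq ?enum_uniq // => b b'; rewrite !mem_enum !inE.
  move=> /tpart_ord h /tpart_ord h' e.
  have := tpart_diag h h' e; case: b b' h h' e => r c [r' c'] /= h h' e e'.
  rewrite /content /= in e; have l1 := ltn_ord r; have l2 := ltn_ord r'.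
  by congr pair; apply: val_inj => /=; lia.
- by rewrite -[v]/(val (Ordinal vn)) nth_rows (sorted_uniq ltn_trans ltnn) // srow_sorted.
move=> a; apply/mapP/idP => [[b]|/mem_svt_rows[i [c [h ->]]]].
  rewrite mem_enum inE => /tpart_ord h ->.
  by apply/mem_svt_rows; eexists _, _; split; [exact: h|].
have [v' [b [ev ei ec hb]]] := tpart_box h.
exists b; last by rewrite /content ei ec.
by rewrite mem_enum inE; have -> : Ordinal vn = v' by apply: val_inj.
Qed.

Lemma tab_sizeE : tab_size T = size (flatten ds).
Proof.
rewrite size_flatten /shape -tab_wtE /tab_wt sumnE big_map big_enum /=.
rewrite /tab_size (eq_bigr (fun b => \sum_(v < n) (v \in T b))); last first.
  by move=> b _; rewrite -sum1_card big_mkcond.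
rewrite exchange_big /=; apply: eq_bigr => v _.
by rewrite cardsE -sum1_card [RHS]big_mkcond.
Qed.
End Weights.

(** * Pipe dreams as words *)

Lemma valid_letter_bound n p u a : valid n p u -> a \in u ->
  exists2 i, i < n & a < run p u i.
Proof.
elim: u p => //= b u IH p /andP[ok v]; rewrite inE => /orP[/eqP ->|h]; last exact: IH.
have /andP[_ /occP[i i_n e]] := occ_hop ok.
exists i => //; have := run_ge (fun i => hop b (p i)) u i; rewrite e; exact.
Qed.

(* Before row [v] is read, the particles [i < n - v] have not moved. *)
Lemma valid_row_ge n p k ds : k <= n -> size ds <= k ->
  (forall i, i < k -> p i = i) -> all (sorted ltn) ds ->
  valid n p (flatten ds) ->
  forall v a, a \in nth [::] ds v -> k - v.+1 <= a.
Proof.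
elim: ds p k => [|d ds IH] p k kn; first by move=> _ _ _ _ v a; rewrite nth_nil.
case: k kn => // k kn; rewrite [size _]/= ltnS => sd pk /= /andP[sd1 sds].
rewrite valid_cat => /andP[vd vds].
have ge a : a \in d -> k <= a.
  case: d sd1 vd {vds} => // b d sd1 /= /andP[ok _].
  have kb : k <= b.
    rewrite leqNgt; apply/negP => bk; move: ok.
    have -> : occ n p b by apply/occP; exists b; [lia|apply: pk; lia].
    have -> // : occ n p b.+1 by apply/occP; exists b.+1; [lia|apply: pk; lia].
  rewrite inE => /orP[/eqP ->//|h].
  have /allP/(_ _ h) := order_path_min ltn_trans sd1; rewrite /=; lia.
have stay u i : i < k -> all (fun a => k <= a) u -> run p u i = i.
  move=> ik; have : p i = i by apply: pk; lia.
  elim: u p {pk vd vds} => //= a u IHu p pi /andP[ka hu]; apply: IHu => //.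
  by rewrite pi /hop; case: eqP => //; lia.
move=> [|v] a /= h; first by rewrite subn1; exact: ge.
rewrite subSS; apply: (IH (run p d)) => //; first by lia.
by move=> i ik; apply: stay => //; apply/allP => b /ge.
Qed.

Section PipeDream.
Variables (n N : nat) (lam : seq nat).
Hypotheses (lam_part : is_partition lam) (n_gt0 : 0 < n) (size_lam : size lam <= n)
  (nN : n + head 0 lam <= N).
Implicit Types (P : {set 'I_N * 'I_N}) (D : n.-tuple {set 'I_N}).

Definition pd_row P (i : 'I_N) : seq nat :=
  [seq val i + val j | j <- enum 'I_N & (i, j) \in P].

Definition pd_word P : seq nat := flatten [seq pd_row P i | i <- rev (enum 'I_N)].

Definition pd_support P : bool :=
  [forall p : 'I_N * 'I_N, (p \in P) ==> (val p.1 + val p.2 + 2 <= N)].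

Lemma pd_rowP P i a : reflect (exists2 j : 'I_N, (i, j) \in P & a = i + j) (a \in pd_row P i).
Proof.
apply: (iffP mapP) => [[j]|[j h ->]].
  by rewrite mem_filter => /andP[h _] ->; exists j.
by exists j => //; rewrite mem_filter h mem_enum.
Qed.

Lemma pd_row_sorted P i : sorted ltn (pd_row P i).
Proof.
rewrite sorted_map; apply: sorted_filter; first by move=> x y z /=; apply: ltn_trans.
have := iota_ltn_sorted 0 N; rewrite -val_enum_ord sorted_map.
by apply: sub_sorted => j j' /=; rewrite ltn_add2l.
Qed.

Lemma reading_wordE P : reading_word P = rev [seq a.+1 | a <- pd_word P].
Proof.
rewrite /pd_word map_flatten rev_flatten /reading_word; congr flatten.
rewrite -[in RHS]map_comp -[in RHS]map_comp [in RHS]map_rev revK; apply: eq_map => i /=.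
by rewrite filter_rev map_rev /pd_row -[in RHS]map_comp.
Qed.

Lemma pd_word_lt P : pd_support P -> all (fun a => a.+1 < N) (pd_word P).
Proof.
move=> /forallP h; apply/allP => a /flattenP[s /mapP[i _ ->] /pd_rowP[j hij ->]].
by have := implyP (h (i, j)) hij; rewrite /=; lia.
Qed.

Lemma is_pdE P : is_pd (grass_code n lam) P = pd_support P && word_of n lam (pd_word P).
Proof.
rewrite /is_pd -/(pd_support P); case hs: (pd_support P) => //=.
rewrite reading_wordE; apply: lehmer_code_word_of => //; first by lia.
exact: pd_word_lt.
Qed.

Lemma invs_pd P : is_pd (grass_code n lam) P -> invs N (demazure (reading_word P)) = sumn lam.
Proof.
case/andP => _ /forallP h; rewrite /invs big_add1 big_mkord.
rewrite (eq_bigr (fun i : 'I_N => grass_code n lam i.+1)); last by move=> i _; apply/eqP.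
rewrite -(sum_nth_lam size_lam) (big_ord_widen N (fun i => nth 0 lam (n - i.+1))); last by lia.
by rewrite [RHS]big_mkcond.
Qed.

(** The rows with index at least [n] are read first, while all particles are at their origins below
    [n]; a letter of such a row is at least [n] and finds both of its places empty. *)
Lemma pd_row_empty P : valid n id (pd_word P) -> forall i : 'I_N, n <= i -> pd_row P i = [::].
Proof.
move=> val i ni; pose f (i : 'I_N) := n <= i.
have e : rev (enum 'I_N) =
   [seq i <- rev (enum 'I_N) | f i] ++ [seq i <- rev (enum 'I_N) | ~~ f i].
  have srt : sorted (fun i j : 'I_N => j < i) (rev (enum 'I_N)).
    rewrite rev_sorted; have := iota_ltn_sorted 0 N.
    by rewrite -val_enum_ord sorted_map.
  apply: (sorted_eq (leT := fun i j : 'I_N => j <= i)).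
  - by move=> x y z /= h1 h2; lia.
  - by move=> x y /= h; apply: val_inj => /=; lia.
  - by apply: sub_sorted srt => x y /= /ltnW.
  - have tr : transitive (fun i j : 'I_N => j < i) by move=> x y z /= h1 h2; lia.
    rewrite (@sorted_pairwise _ (fun i j : 'I_N => j <= i)); last by move=> x y z /= h1 h2; lia.
    rewrite pairwise_cat; apply/and3P; split.
    + apply/allrelP => x y; rewrite !mem_filter /f => /andP[h1 _] /andP[h2 _]; lia.
    + rewrite -sorted_pairwise; last by move=> x y z /= h1 h2; lia.
      by apply: (sub_sorted (e := fun i j : 'I_N => j < i)) => [x y /= /ltnW //|];
         apply: sorted_filter.
    + rewrite -sorted_pairwise; last by move=> x y z /= h1 h2; lia.
      by apply: (sub_sorted (e := fun i j : 'I_N => j < i)) => [x y /= /ltnW //|];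
         apply: sorted_filter.
  - by rewrite perm_sym perm_filterC.
have : flatten [seq pd_row P i | i <- rev (enum 'I_N) & f i] = [::].
  move: val; rewrite /pd_word {1}e map_cat flatten_cat valid_cat => /andP[+ _].
  case E: (flatten _) => [//|a s] /= /andP[ok _].
  have : a \in flatten [seq pd_row P i | i <- rev (enum 'I_N) & f i] by rewrite E mem_head.
  move=> /flattenP[r /mapP[i' ]]; rewrite mem_filter => /andP[ni' _] -> /pd_rowP[j _ ea].
  have na : n <= a by rewrite /f in ni'; lia.
  have no b : n <= b -> occ n id b = false.
    by move=> nb; apply/negP => /occP[i0 i0n]; lia.
  by move: ok; rewrite !no //; lia.
move=> E; case R: (pd_row P i) => [//|a r].
suff : a \in ([::] : seq nat) by [].
rewrite -E; apply/flattenP; exists (pd_row P i); last by rewrite R mem_head.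
by apply/mapP; exists i => //; rewrite mem_filter mem_rev mem_enum andbT.
Qed.

Definition pd_of D : {set 'I_N * 'I_N} :=
  [set p : 'I_N * 'I_N | (p.1 < n) && (p.1 + p.2 \in nth [::] (rows D) (n - p.1.+1))].

Definition rows_of P : n.-tuple {set 'I_N} :=
  [tuple [set a : 'I_N | [exists i : 'I_N, (i == n - v.+1 :> nat) && (val a \in pd_row P i)]] | v < n].

Lemma mem_rows_of P v a : (forall i b, b \in pd_row P i -> b < N) -> v < n ->
  a \in nth [::] (rows (rows_of P)) v <->
  exists2 i : 'I_N, i = n - v.+1 :> nat & a \in pd_row P i.
Proof.
move=> lt vn; rewrite -[v]/(val (Ordinal vn)) nth_rows tnth_mktuple; split.
  case/mapP => a'; rewrite mem_enum inE => /existsP[i /andP[/eqP e h]] ->.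
  by exists i.
case=> i e h; apply/mapP; exists (Ordinal (lt _ _ h)) => //.
by rewrite mem_enum inE; apply/existsP; exists i; rewrite e eqxx.
Qed.

Lemma pd_row_lt P : pd_support P -> forall i b, b \in pd_row P i -> b < N.
Proof.
by move=> /forallP h i b /pd_rowP[j hij ->]; have := implyP (h (i, j)) hij => /=; lia.
Qed.

Lemma rows_ofK P : is_pd (grass_code n lam) P -> pd_of (rows_of P) = P.
Proof.
rewrite is_pdE => /andP[sup /andP[valid_u _]].
have lt := pd_row_lt sup.
apply/setP => -[i j]; rewrite inE /=; case: (ltnP i n) => /= hi; last first.
  apply/esym/negbTE/negP => h.
  suff : val i + val j \in ([::] : seq nat) by [].
  by rewrite -(pd_row_empty valid_u hi); apply/pd_rowP; exists j.
have e : n - (n - i.+1).+1 = i by lia.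
have vn : n - i.+1 < n by lia.
have mr := mem_rows_of (P := P) (i + j) lt vn.
apply/idP/idP => [/mr[i' ei /pd_rowP[j' h eij]]|h].
  have ei' : i' = i by apply: val_inj; rewrite /= ei e.
  rewrite ei' in h eij; have -> // : j = j'.
  by apply: val_inj => /=; lia.
by apply/mr; exists i; rewrite ?e //; apply/pd_rowP; exists j.
Qed.

(** The lower bound makes the column [a - i] of the cross meaningful in row [i = n - v.+1], and the
    upper one places the cross in the staircase. *)
Definition rows_good D := forall v a, a \in nth [::] (rows D) v -> n - v.+1 <= a /\ a.+1 < N.

Lemma word_of_good D : word_of n lam (flatten (rows D)) -> rows_good D.
Proof.
move=> /andP[val /allP fin] v a h; have sd : size (rows D) = n by rewrite size_map size_tuple.
have vn : v < n.
  by rewrite ltnNge; apply/negP => nv; rewrite nth_default // sd in h.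
split.
  by apply: (valid_row_ge (p := id) (leqnn n) _ _ (rows_sorted D) val h) => //; rewrite sd.
have ha : a \in flatten (rows D).
  by apply/flattenP; exists (nth [::] (rows D) v) => //; apply: mem_nth; rewrite sd.
have [i i_n lt] := valid_letter_bound val ha.
have := fin i; rewrite mem_iota add0n i_n => /(_ isT)/eqP er.
have := partition_head (n - i.+1) lam_part; lia.
Qed.

Lemma pd_row_pd_of D (i : 'I_N) : rows_good D ->
  pd_row (pd_of D) i = if i < n then nth [::] (rows D) (n - i.+1) else [::].
Proof.
move=> good; apply: (irr_sorted_eq ltn_trans ltnn); first exact: pd_row_sorted.
  case: ifP => // hi; have vn : n - i.+1 < n by lia.
  by rewrite -[n - _]/(val (Ordinal vn)) nth_rows srow_sorted.
move=> a; apply/pd_rowP/idP => [[j]|].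
  by rewrite inE /= => /andP[-> h] ->.
case: ifP => // hi h; have [h1 h2] := good _ _ h.
have aN : a - i < N by lia.
exists (Ordinal aN); last by rewrite /=; lia.
rewrite inE /= hi /=; have -> : i + (a - i) = a by lia.
exact: h.
Qed.

Lemma pd_word_pd_of D : rows_good D -> pd_word (pd_of D) = flatten (rows D).
Proof.
move=> good; pose f i := if i < n then nth [::] (rows D) (n - i.+1) else [::].
rewrite /pd_word (eq_map (g := f \o val)); last by move=> i; rewrite pd_row_pd_of.
rewrite map_comp map_rev val_enum_ord.
have -> : iota 0 N = iota 0 (n + (N - n)) by congr iota; lia.
rewrite iotaD rev_cat map_cat flatten_cat add0n.
have -> : flatten [seq f i | i <- rev (iota n (N - n))] = [::].
  case E: (flatten _) => [//|a s].
  have : a \in flatten [seq f i | i <- rev (iota n (N - n))] by rewrite E mem_head.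
  move=> /flattenP[r /mapP[i]]; rewrite mem_rev mem_iota => /andP[ni _] ->.
  by rewrite /f ltnNge ni.
rewrite cat0s; congr flatten.
have sd : size (rows D) = n by rewrite size_map size_tuple.
apply: (@eq_from_nth _ [::]); first by rewrite size_map size_rev size_iota sd.
move=> v; rewrite size_map size_rev size_iota => vn.
rewrite (nth_map 0) ?size_rev ?size_iota // nth_rev ?size_iota // nth_iota; last by lia.
rewrite /f add0n (_ : n - v.+1 < n); last by lia.
by congr nth; lia.
Qed.

Lemma pd_ofK D : rows_good D -> rows_of (pd_of D) = D.
Proof.
move=> good; apply: rows_inj; apply: (@eq_from_nth _ [::]).
  by rewrite [LHS]size_map [RHS]size_map !size_tuple.
move=> v; rewrite size_map size_tuple => vn.
apply: (irr_sorted_eq ltn_trans ltnn).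
- by rewrite -[v]/(val (Ordinal vn)) nth_rows srow_sorted.
- by rewrite -[v]/(val (Ordinal vn)) nth_rows srow_sorted.
have lt i b : b \in pd_row (pd_of D) i -> b < N.
  by rewrite pd_row_pd_of //; case: ifP => // _ /good[]; lia.
have iN : n - v.+1 < N by lia.
have e : n - (n - v.+1).+1 = v by lia.
move=> a; apply/idP/idP.
  move/(mem_rows_of a lt vn) => [i ei]; rewrite pd_row_pd_of // ei.
  by rewrite e; case: ifP.
move=> h; apply/(mem_rows_of a lt vn); exists (Ordinal iN) => //.
by rewrite pd_row_pd_of //= e ifT //; lia.
Qed.

Lemma is_pd_pd_of D :
  is_pd (grass_code n lam) (pd_of D) && (rows_of (pd_of D) == D) =
  word_of n lam (flatten (rows D)).
Proof.
apply/andP/idP => [[hpd /eqP eD]|w].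
  move: hpd; rewrite is_pdE => /andP[sup w].
  suff good : rows_good D by rewrite -pd_word_pd_of.
  move=> v a h; case: (ltnP v n) => vn; last by rewrite nth_rows_default in h.
  have := h; rewrite -eD => /(mem_rows_of a (pd_row_lt sup) vn)[i ei hi].
  case/pd_rowP: (hi) => j hij ea; split; first by rewrite ea ei leq_addr.
  by have := implyP (forallP sup (i, j)) hij; rewrite /=; lia.
have good := word_of_good w; rewrite pd_ofK // eqxx; split=> //.
rewrite is_pdE pd_word_pd_of // w andbT; apply/forallP => -[i j]; apply/implyP.
by rewrite inE /= => /andP[_ /good[_]]; lia.
Qed.

Local Open Scope ring_scope.
Variables (R : comPzRingType) (beta : R) (x : nat -> R).

Lemma rows_mon_prod ds : rows_mon x ds =
  \prod_(v < size ds) x (size ds - v)%N ^+ size (nth [::] ds v).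
Proof.
elim: ds => [|d ds IH]; first by rewrite big_ord0.
rewrite big_ord_recl /= subn0; congr (_ * _).
by rewrite IH; apply: eq_bigr => v _; rewrite /bump /= add1n subSS.
Qed.

Lemma pd_weight D : rows_good D ->
  \prod_(p in pd_of D) x (val p.1).+1 = rows_mon x (rows D).
Proof.
move=> good; have sz i P : size (pd_row P i) = (\sum_(j | (i, j) \in P) 1)%N.
  by rewrite size_map -sum1_size big_filter big_enum_cond.
transitivity (\prod_(i : 'I_N) x i.+1 ^+ size (pd_row (pd_of D) i)).
  rewrite (eq_bigr (fun i : 'I_N => \prod_(j | (i, j) \in pd_of D) x i.+1)).
    by rewrite pair_big_dep /=; apply: eq_bigl => -[i j].
  by move=> i _; rewrite sz -prodrXr; apply: eq_bigr => j _; rewrite expr1.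
have sd : size (rows D) = n by rewrite size_map size_tuple.
rewrite rows_mon_prod sd [RHS](reindex_inj rev_ord_inj) /=.
rewrite (big_ord_widen N (fun i => x (n - (n - i.+1))%N ^+ size (nth [::] (rows D) (n - i.+1)))); last by lia.
rewrite [RHS]big_mkcond; apply: eq_bigr => i _; rewrite pd_row_pd_of //.
by case: ifP => hi; rewrite ?expr0 //; congr (x _ ^+ _); lia.
Qed.

Lemma pd_card D : rows_good D -> #|pd_of D| = size (flatten (rows D)).
Proof.
move=> good; rewrite -pd_word_pd_of // /pd_word size_flatten /shape sumnE.
rewrite !big_map big_rev big_enum /= -sum1_card.
rewrite (eq_bigr (fun i : 'I_N => \sum_(j | (i, j) \in pd_of D) 1))%N.
  by rewrite pair_big_dep /=; apply: eq_bigl => -[i j].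
by move=> i _; rewrite size_map -sum1_size big_filter big_enum_cond.
Qed.

Lemma groth_box_rows :
  groth_box N (grass_code n lam) beta x =
  \sum_(D : n.-tuple {set 'I_N} | word_of n lam (flatten (rows D)))
    beta ^+ (size (flatten (rows D)) - sumn lam) * rows_mon x (rows D).
Proof.
rewrite /groth_box (reindex_onto pd_of rows_of) /=; last exact: rows_ofK.
rewrite (eq_bigl _ _ is_pd_pd_of); apply: eq_bigr => D w.
have good := word_of_good w.
rewrite pd_card // pd_weight //; congr (beta ^+ (_ - _) * _).
by apply: invs_pd; move: w; rewrite -is_pd_pd_of => /andP[].
Qed.
End PipeDream.

(** * The expansion *)

Lemma flatten_nseq_nil (T : Type) k : flatten (nseq k [::]) = [::] :> seq T.
Proof. by elim: k. Qed.

Lemma exists_qy_rows n N (D : n.-tuple {set 'I_N}) :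
  exists Q : n.-tuple {set 'I_N},
    qy_rows (rows Q) /\ flatten (rows Q) = dedup (flatten (rows D)).
Proof.
set e := dedup (flatten (rows D)).
have se : size (runs e) <= n.
  rewrite -(size_map size) shape_runs.
  by have := size_run_lengths_flatten (rows_sorted D); rewrite size_map size_tuple.
have fe : flatten (runs e ++ nseq (n - size (runs e)) [::]) = e.
  by rewrite flatten_cat flatten_runs flatten_nseq_nil cats0.
have [|||Q eQ] := @rows_onto N n (runs e ++ nseq (n - size (runs e)) [::]).
- by rewrite size_cat size_nseq subnKC.
- by rewrite all_cat runs_sorted all_nseq orbT.
- by rewrite fe; apply/allP => a /dedup_sub/(allP (flatten_rows_lt D)).
exists Q; rewrite eQ fe; split=> //.
exact/qy_rows_cat_nil/runs_qy_rows/nadj_dedup.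
Qed.

Lemma qy_rows_inj n N (Q Q' : n.-tuple {set 'I_N}) :
  qy_rows (rows Q) -> qy_rows (rows Q') -> flatten (rows Q) = flatten (rows Q') -> Q = Q'.
Proof.
move=> h h' e; apply: rows_inj.
rewrite (qy_rows_runs (rows_sorted Q) h) (qy_rows_runs (rows_sorted Q') h') e.
by rewrite /rows !size_map !size_tuple.
Qed.

(* Consecutive rows of a quasi-Yamanouchi filling meet in a strict descent. *)
Lemma qy_rows_nadj qs : all (sorted ltn) qs -> qy_rows qs -> nadj (flatten qs).
Proof.
elim: qs => // q qs IH; rewrite [all _ _]/= => /andP[sq sqs] hq.
have hq' : qy_rows qs by case/andP: hq.
have nq : nadj q by apply: sub_sorted sq => x y /=; rewrite ltn_neqAle => /andP[].
have {IH} nqs := IH sqs hq'.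
case: (eqVneq q [::]) hq => [-> //|q0] /= /andP[hd _].
case: q q0 sq nq hd => // x q _ sq nq hd; rewrite /nadj /= cat_path -[path _ x q]/(nadj (x :: q)) nq /=.
case: qs sqs hq' nqs hd => // q' qs _ hq'; case: q' hq' => [|y q'] hq' nqs /=.
  by move: hq' => /qy_rows_nil ->; rewrite flatten_nseq_nil.
by move=> lt; rewrite -[path _ y _]/(nadj (flatten ((y :: q') :: qs))) nqs andbT; lia.
Qed.

Local Open Scope ring_scope.

(** The row lengths are the run lengths followed by zeros; reversed, they put the zeros in front, as
    [glide_poly_komp_sum] requires. *)
Lemma glide_poly_rows (R : comPzRingType) (beta : R) (x : nat -> R) n N
    (Q : n.-tuple {set 'I_N}) : qy_rows (rows Q) ->
  glide_poly (rev [seq size d | d <- rows Q]) beta x =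
  word_sum beta x N n (flatten (rows Q)).
Proof.
move=> hq; set e := flatten _; set a := rev _.
have sa : size a = n by rewrite size_rev !size_map size_tuple.
have ne : nadj e by apply: qy_rows_nadj => //; apply: rows_sorted.
have ra : rev a = run_lengths e ++ nseq (size a - size (run_lengths e)) 0%N.
  rewrite revK {1}(qy_rows_runs (rows_sorted Q) hq) map_cat shape_runs map_nseq.
  by rewrite sa -shape_runs !size_map size_tuple.
rewrite (glide_poly_komp_sum beta x (run_lengths_gt0 e) ra) sa.
rewrite (@word_sum_komp _ _ _ _ (glide_bound a)) //; first exact: flatten_rows_lt.
by rewrite /glide_bound /a sumn_rev /e size_flatten addn1 ltnS leq_addr.
Qed.

Theorem mainTheorem5 (R : comPzRingType) (n : nat) (lam : seq nat) (N : nat)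
    (beta : R) (x : nat -> R) :
  is_partition lam -> lam != [::] -> (size lam <= n)%N ->
  (n + head 0%N lam <= N)%N ->
  groth_box N (grass_code n lam) beta x =
  \sum_(T : tabT n lam | QSV T)
     beta ^+ (tab_size T - sumn lam) * glide_poly (rev (tab_wt T)) beta x.
Proof.
move=> lam_part lam0 size_lam nN.
have n_gt0 : (0 < n)%N by apply: leq_trans size_lam; case: (lam) lam0.
rewrite (groth_box_rows lam_part n_gt0 size_lam nN).
rewrite [RHS](reindex_onto (fun D : n.-tuple {set 'I_N} => tab_of_word n lam D)
  (word_of_tab N)) /=; last first.
  by move=> T /andP[svtT _]; apply: word_of_tabK.
pose qy_word (D : n.-tuple {set 'I_N}) :=
  word_of n lam (flatten (rows D)) && qy_rows (rows D).
rewrite [RHS](eq_bigl qy_word); last first.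
  move=> D; rewrite /QSV /qy_word; apply/andP/andP => [[/andP[svtT hq] /eqP eD]|[w hq]].
    rewrite -[in word_of _ _ _]eD -[in qy_rows _]eD -is_qyE //; split=> //.
    exact: svt_word_of.
  have svtT := tab_of_word_svt lam_part n_gt0 nN w.
  by rewrite svtT (is_qyE lam_part n_gt0 nN) // tab_of_wordK // eqxx.
(* Words are grouped by their merged word, each group being represented by its unique
   quasi-Yamanouchi filling. The default [D] is never taken, by [exists_qy_rows]. *)
pose qof (D : n.-tuple {set 'I_N}) := odflt D
  [pick Q : n.-tuple {set 'I_N} | qy_rows (rows Q) && (flatten (rows Q) == dedup (flatten (rows D)))].
have qofP D : qy_rows (rows (qof D)) /\ flatten (rows (qof D)) = dedup (flatten (rows D)).
  rewrite /qof; case: pickP => [Q /andP[h /eqP //]|no].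
  by have [Q [h e]] := exists_qy_rows D; have := no Q; rewrite h e eqxx.
rewrite (partition_big qof qy_word) /=; last first.
  by move=> D w; have [h e] := qofP D; rewrite /qy_word h e word_of_dedup w.
apply: eq_bigr => Q /andP[w hq].
have svtT := tab_of_word_svt lam_part n_gt0 nN w.
rewrite (tab_wtE lam_part n_gt0 nN) // (tab_sizeE lam_part n_gt0 nN) // tab_of_wordK //.
rewrite glide_poly_rows // /word_sum mulr_sumr; apply: eq_big => [D|D /andP[wD /eqP eD]].
  have [h e] := qofP D; apply/andP/eqP => [[_ /eqP <-]|eD]; first by rewrite e.
  split; first by rewrite -word_of_dedup eD.
  by apply/eqP/qy_rows_inj => //; rewrite e.
have [_ e] := qofP D; rewrite eD in e.
rewrite mulrA -exprD e; congr (beta ^+ _ * _).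
(* The two truncated differences add up since $|\lambda| \le |T|$ and $|T|$ is at most the length of
   the word of [D]. *)
have := size_dedup (flatten (rows D)); have := word_of_size size_lam w; rewrite e; lia.
Qed.
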